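(* Let $0<\alpha<2$ and $\delta=\delta(\alpha)=\min\{1/4,(3C)^{-1/(1+\alpha)}\}$ with $C=2^{\alpha+1}(1+2\alpha)$. Let $\rho$ be a classical solution on $\mathbb{T}\times[0,\infty)$ of $\partial_t\rho+\partial_x(\rho u)=0$, $u=H\Lambda^{\alpha-1}\rho$, with smooth $1$-periodic initial datum $\rho_0$ satisfying (H1), (H2), (H3), and let $m=\int_{\mathbb{T}}\rho_0(x)\,dx>0$. Then there is a constant $A=A(\alpha,m,\rho_{\max})>0$ such that for every $(x,t)$ with $x\in[0,\delta]$, $t\ge0$ and $\rho(x,t)\le m/2$, one has $$u(x,t)\le -A\,x.$$
   Context: $\mathbb{T}=\mathbb{R}/\mathbb{Z}$ identified with $[-1/2,1/2)$; functions on $\mathbb{T}$ are identified with their $1$-periodic extensions. $u(x,t)=c_\alpha\,\mathrm{P.V.}\int_{\mathbb{R}}\frac{\rho(y,t)-\rho(x,t)}{\mathrm{sgn}(x-y)|x-y|^{\alpha}}dy$ with $c_\alpha>0$ the constant for which $\Lambda^\alpha f(x)=c_\alpha\,\mathrm{P.V.}\int_{\mathbb{R}}\frac{f(x)-f(y)}{|x-y|^{1+\alpha}}dy$. (H1) $\rho_0(x)=\rho_0(-x)$; (H2) $0\le\rho_0\le\rho_{\max}$ for a constant $\rho_{\max}>0$; (H3) $\rho_0(0)=0$ and $\partial_x\rho_0\ge0$ on $[0,1/2]$. *)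

(* Defs.v *)
From Stdlib Require Import Reals Lra.
Open Scope R_scope.

Definition integral_eq (f : R -> R) (a b v : R) : Prop :=
  exists pr : Riemann_integrable f a b, RiemannInt pr = v.

(* Principal value integral over R centred at x:
   l = lim_{e -> 0+} ( int_{x-1/e}^{x-e} f + int_{x+e}^{x+1/e} f ),
   i.e. singularity at x removed symmetrically and the integral at infinity
   taken symmetrically as well. *)
Definition PV_R (f : R -> R) (x l : R) : Prop :=
  forall eps, 0 < eps -> exists d, 0 < d /\
    forall e, 0 < e < d -> exists v1 v2,
      integral_eq f (x - / e) (x - e) v1 /\
      integral_eq f (x + e) (x + / e) v2 /\
      Rabs (v1 + v2 - l) < eps.

Definition sgn (z : R) : R :=
  if Rlt_dec 0 z then 1 else if Rlt_dec z 0 then -1 else 0.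

(* c_alpha: the normalising constant of Lambda^alpha = (-Delta)^{alpha/2}
   (Fourier multiplier |xi|^alpha), in the singular-integral form
   Lambda^alpha f(x) = c PV int (f(x)-f(y))/|x-y|^{1+alpha} dy.
   Testing on f = cos (Lambda^alpha cos = cos) at x = 0 determines c:
   c * PV int (1 - cos y)/|y|^{1+alpha} dy = 1. *)
Definition c_alpha_spec (alpha c : R) : Prop :=
  exists l, PV_R (fun y => (1 - cos y) / Rpower (Rabs y) (1 + alpha)) 0 l /\
            c * l = 1.

Definition velocity_formula (alpha c : R) (rho u : R -> R -> R) : Prop :=
  forall x t, 0 <= t ->
    exists l,
      PV_R (fun y => (rho y t - rho x t) /
                     (sgn (x - y) * Rpower (Rabs (x - y)) alpha)) x l /\
      u x t = c * l.

Definition cont2_on (f : R -> R -> R) (P : R -> R -> Prop) : Prop :=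
  forall x t, P x t -> forall eps, 0 < eps -> exists d, 0 < d /\
    forall y s, P y s -> Rabs (y - x) < d -> Rabs (s - t) < d ->
      Rabs (f y s - f x t) < eps.

Definition smooth (f : R -> R) : Prop :=
  exists D : nat -> R -> R, D O = f /\
    forall n x, derivable_pt_lim (D n) x (D (S n) x).

Definition classical_solution (rho0 : R -> R) (rho u : R -> R -> R) : Prop :=
  (forall x t, 0 <= t -> rho (x + 1) t = rho x t) /\
  (forall x, rho x 0 = rho0 x) /\
  exists rho_x rho_t flux_x : R -> R -> R,
    (forall x t, 0 <= t -> derivable_pt_lim (fun y => rho y t) x (rho_x x t)) /\
    (forall x t, 0 < t -> derivable_pt_lim (fun s => rho x s) t (rho_t x t)) /\
    (forall x t, 0 < t ->
       derivable_pt_lim (fun y => rho y t * u y t) x (flux_x x t)) /\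
    (forall x t, 0 < t -> rho_t x t + flux_x x t = 0) /\
    cont2_on rho (fun _ t => 0 <= t) /\
    cont2_on rho_x (fun _ t => 0 <= t) /\
    cont2_on rho_t (fun _ t => 0 < t).

Definition C_const (alpha : R) : R :=
  Rpower 2 (alpha + 1) * (1 + 2 * alpha).

Definition delta_const (alpha : R) : R :=
  Rmin (1 / 4) (Rpower (3 * C_const alpha) (- (1 / (1 + alpha)))).

(* Main.v *)
Require Import Defs.
From Stdlib Require Import Reals.
From Coquelicot Require Import Coquelicot.
From Stdlib Require Import Lra Lia ZArith Psatz Classical.
Open Scope R_scope.

(** Let F(x,t) be the integral of rho(.,t) over [0,x]. Then F_t = -F_x u up to a
function of t, and, since k(z) = z^(-alpha) is decreasing, integration by parts
turns -u(x) into an integral, against a positive kernel, of the second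
differences z |-> F(x+z) + F(x-z) - 2F(x). So combinations of values of F obey
maximum principles: at an extremum the first-order conditions equate the
densities rho at the points involved, the time derivative is this common density
times a combination of velocities, and the latter has a sign. This gives, in turn:
- rho >= 0: at a negative minimum of F(x+h) - F(x) the density, hence the flux,
  vanishes at both ends, for any u;
- rho stays even: use F(x) + F(-x) - F(y) - F(-y);
- F(a+h) + F(a-h) - 2F(a) >= 0 for a in [0,1/2] and all h, so that rho stays
  nondecreasing on [0,1/2]. This function of a is odd and 1-periodic, hence not
  globally minimal at its minimum over [0,1/2]; the reflection is handled by
  integrating by parts three times, k being completely monotone.
With these second differences nonnegative, the bound on u follows from the
average over z of F(x+z) + F(x-z) - 2F(x), which is 2mx - 2F(x) >= mx as soon as
rho(x) <= m/2. *)

(** * Compactness and a maximum principle *)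

(** Compactness as an induction principle: [Small] is an ideal of sets, and a set that is locally
    small is small. Reading [Small A] as being covered by finitely many members of an open cover
    recovers the usual notion, without handling finite subfamilies. *)
Definition covering_compact {X : UniformSpace} (K : X -> Prop) : Prop :=
  forall Small : (X -> Prop) -> Prop,
    Small (fun _ => False) ->
    (forall A B, Small A -> Small B -> Small (fun x => A x \/ B x)) ->
    (forall A B : X -> Prop, (forall x, A x -> B x) -> Small B -> Small A) ->
    (forall x, K x -> exists V, locally x V /\ Small V) ->
    Small K.

(** Supremum argument: if [c] is the supremum of the [z] for which [a, z] is small, a small
    neighbourhood of [c] carries smallness beyond [c], so [b] is reached. *)
Lemma segment_compact (a b : R) :
  covering_compact (X := R_UniformSpace) (fun x => a <= x <= b).
Proof.
intros Small H0 HU Hsub Hloc.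
destruct (Rlt_le_dec b a) as [Hba|Hab].
{ apply (Hsub _ (fun _ => False)); [intros x Hx; lra|exact H0]. }
set (E := fun z => a <= z <= b /\ Small (fun x : R => a <= x <= z)).
assert (Ea : E a).
{ split; [lra|].
  destruct (Hloc a) as [V [[d HV] SV]]; [lra|].
  apply (Hsub _ V); [|exact SV].
  intros x Hx; apply HV; replace x with a by lra; apply ball_center. }
assert (Eb : bound E) by (exists b; intros z [Hz _]; lra).
destruct (completeness E Eb (ex_intro _ a Ea)) as [c [Hub Hlub]].
assert (Hc : a <= c <= b).
{ split; [apply Hub, Ea|]. apply Hlub; intros z [Hz _]; lra. }
destruct (Hloc c Hc) as [V [[d HV] SV]].
assert (HzE : exists z, E z /\ c - d < z).
{ apply NNPP; intros Hn.
  assert (Hle : c <= c - d).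
  { apply Hlub; intros z Ez; apply Rnot_lt_le; intros Hlt; apply Hn; exists z; tauto. }
  destruct d as [d Hd]; simpl in *; lra. }
destruct HzE as [z [[Hz Sz] Hzd]].
assert (Hzc : z <= c) by (apply Hub; split; assumption).
assert (Sw : forall w, a <= w <= b -> w < c + d -> Small (fun x : R => a <= x <= w)).
{ intros w Hw Hwd.
  apply (Hsub _ (fun x => a <= x <= z \/ V x)); [|apply HU; assumption].
  intros x Hx; destruct (Rle_lt_dec x z) as [H|H]; [left; lra|right].
  apply HV; apply Rabs_def1; unfold minus, plus, opp; simpl; lra. }
destruct (Rlt_le_dec b (c + d)) as [Hbd|Hbd].
{ apply Sw; lra. }
assert (Hd := cond_pos d).
assert (Hm : E (c + d / 2)) by (split; [lra|apply Sw; lra]).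
apply Hub in Hm; lra.
Qed.

(** Tube argument: compactness of [K1] is applied to the sets whose product with [K2] is small and,
    around each [x], compactness of [K2] to the sets having a small product with some neighbourhood
    of [x]. *)
Lemma product_compact {X Y : UniformSpace} (K1 : X -> Prop) (K2 : Y -> Prop) :
  covering_compact K1 -> covering_compact K2 ->
  covering_compact (X := prod_UniformSpace X Y) (fun p => K1 (fst p) /\ K2 (snd p)).
Proof.
intros C1 C2 Small H0 HU Hsub Hloc.
apply (C1 (fun A => Small (fun p : X * Y => A (fst p) /\ K2 (snd p)))).
- apply (Hsub _ (fun _ => False)); [intros p [[] _]|exact H0].
- intros A B SA SB.
  eapply Hsub; [|exact (HU _ _ SA SB)]; intros p; simpl; tauto.
- intros A B HAB SB; eapply Hsub; [|exact SB]; intros p [Hp Hq]; split; auto.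
- intros x Kx.
  apply (C2 (fun B => exists V, locally x V /\
    Small (fun p : X * Y => V (fst p) /\ B (snd p)))).
  + exists (fun _ => True); split; [apply filter_true|].
    eapply Hsub; [|exact H0]; intros p [_ []].
  + intros A B [V [LV SV]] [W [LW SW]].
    exists (fun z => V z /\ W z); split; [apply filter_and; assumption|].
    eapply Hsub; [|exact (HU _ _ SV SW)]; intros p; simpl; tauto.
  + intros A B HAB [V [LV SV]]; exists V; split; [exact LV|].
    eapply Hsub; [|exact SV]; intros p [Hp Hq]; split; auto.
  + intros y Ky.
    destruct (Hloc (x, y) (conj Kx Ky)) as [V [[d HV] SV]].
    exists (ball y d); split; [apply locally_ball|].
    exists (ball x d); split; [apply locally_ball|].
    eapply Hsub; [|exact SV].
    intros [p q] [Hp Hq]; apply HV; split; assumption.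
Qed.

(** The sets on which [f] stays below a single value attained on [K] form an ideal. Without a
    maximum, [K] would locally, hence globally, belong to it, and the attained value would lie below
    itself. *)
Lemma compact_max {X : UniformSpace} (K : X -> Prop) (f : X -> R) :
  covering_compact K -> (exists x, K x) ->
  (forall x, K x -> continuous f x) ->
  exists x, K x /\ forall y, K y -> f y <= f x.
Proof.
intros CK [x0 K0] Hf.
apply NNPP; intros Hn.
assert (Hgt : forall x, K x -> exists y, K y /\ f x < f y).
{ intros x Kx; apply NNPP; intros Hx; apply Hn; exists x; split; [exact Kx|].
  intros y Ky; apply Rnot_lt_le; intros Hlt; apply Hx; exists y; tauto. }
destruct (CK (fun A => exists y, K y /\ forall x, A x -> f x < f y))
  as [y [Ky Hy]].
- exists x0; split; [exact K0|intros x []].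
- intros A B [y [Ky Hy]] [z [Kz Hz]].
  destruct (Rle_lt_dec (f y) (f z)) as [Hl|Hl];
    [exists z|exists y]; (split; [assumption|]);
    intros x [Ax|Bx]; try (apply Hy in Ax); try (apply Hz in Bx); lra.
- intros A B HAB [y [Ky Hy]]; exists y; split; auto.
- intros x Kx; destruct (Hgt x Kx) as [y [Ky Hy]].
  exists (fun z => f z < f y); split; [|exists y; split; auto].
  apply (Hf x Kx (fun r => r < f y)).
  exact (open_lt (f y) (f x) Hy).
- exact (Rlt_irrefl _ (Hy y Ky)).
Qed.

Lemma is_derive_right_max (f : R -> R) (x d : R) :
  is_derive f x d -> (exists e, 0 < e /\ forall y, x <= y < x + e -> f y <= f x) ->
  d <= 0.
Proof.
intros Hd [e [He Hf]]; apply Rnot_lt_le; intros Hpos.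
apply is_derive_Reals in Hd.
destruct (Hd (d / 2)) as [[r Hr] Hlim]; [lra|]; simpl in Hlim.
set (h := Rmin e r / 2).
assert (Hh : 0 < h < e /\ h < r).
{ unfold h; assert (0 < Rmin e r) by (apply Rmin_pos; lra).
  assert (Rmin e r <= e) by apply Rmin_l; assert (Rmin e r <= r) by apply Rmin_r; lra. }
specialize (Hlim h); rewrite (Rabs_pos_eq h) in Hlim by lra.
assert (Hq := Hlim ltac:(lra) ltac:(lra)).
apply Rabs_def2 in Hq.
assert (Hfx : f (x + h) <= f x) by (apply Hf; lra).
assert (Hle : (f (x + h) - f x) / h <= 0).
{ apply Rmult_le_reg_r with h; [lra|]; field_simplify; lra. }
lra.
Qed.

Lemma is_derive_opp_arg (f : R -> R) (x d : R) :
  is_derive f (- x) d -> is_derive (fun y => f (- y)) x (- d).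
Proof.
intros Hd.
replace (- d) with (scal (-1) d) by (unfold scal; simpl; unfold mult; simpl; ring).
apply (is_derive_comp f Ropp); [exact Hd|auto_derive; auto; ring].
Qed.

Lemma is_derive_left_max (f : R -> R) (x d : R) :
  is_derive f x d -> (exists e, 0 < e /\ forall y, x - e < y <= x -> f y <= f x) ->
  0 <= d.
Proof.
intros Hd [e [He Hf]].
enough (- d <= 0) by lra.
apply (is_derive_right_max (fun y => f (- y)) (- x)).
- apply is_derive_opp_arg; rewrite Ropp_involutive; exact Hd.
- exists e; split; [exact He|]; intros y Hy; rewrite Ropp_involutive; apply Hf; lra.
Qed.

Lemma is_derive_interior_max (f : R -> R) (a b x d : R) :
  is_derive f x d -> a < x < b -> (forall y, a <= y <= b -> f y <= f x) -> d = 0.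
Proof.
intros Hd Hx Hf; apply Rle_antisym.
- apply (is_derive_right_max f x); [exact Hd|].
  exists (b - x); split; [lra|intros y Hy; apply Hf; lra].
- apply (is_derive_left_max f x); [exact Hd|].
  exists (x - a); split; [lra|intros y Hy; apply Hf; lra].
Qed.

(** Subtracting [e * t] makes the comparison strict: a maximum of the penalised function over the
    box and [0, T] is a spatial maximum of [f] at its time, where the time derivative would be at
    least [e]. Clamping time by [Rmax 0] lets continuity be asked at every point. *)
Lemma parabolic_maximum_principle (f : R -> R -> R -> R) (a1 b1 a2 b2 : R) :
  (forall p : R * R * R,
     continuous (fun p : R * R * R =>
       f (fst (fst p)) (snd (fst p)) (Rmax 0 (snd p))) p) ->
  (forall x y, a1 <= x <= b1 -> a2 <= y <= b2 -> f x y 0 <= 0) ->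
  (forall x y t, a1 <= x <= b1 -> a2 <= y <= b2 -> 0 < t -> 0 < f x y t ->
     (forall x' y', a1 <= x' <= b1 -> a2 <= y' <= b2 -> f x' y' t <= f x y t) ->
     exists d, is_derive (fun s => f x y s) t d /\ d <= 0) ->
  forall x y t, a1 <= x <= b1 -> a2 <= y <= b2 -> 0 <= t -> f x y t <= 0.
Proof.
intros Hc H0 Hmax x1 y1 T Hx1 Hy1 HT.
destruct (Rle_lt_or_eq_dec 0 T HT) as [HT0|<-]; [|auto].
apply Rnot_lt_le; intros Hpos.
(* With this size the penalty removes only half of the positive value at time [T]. *)
set (e := f x1 y1 T / (2 * T)).
assert (He : 0 < e) by (apply Rdiv_lt_0_compat; lra).
assert (HeT : e * T = f x1 y1 T / 2) by (unfold e; field; lra).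
pose (g := fun p : R * R * R =>
  f (fst (fst p)) (snd (fst p)) (Rmax 0 (snd p)) - e * snd p).
destruct (compact_max (X := prod_UniformSpace (prod_UniformSpace R_UniformSpace R_UniformSpace) R_UniformSpace)
  (fun p => ((a1 <= fst (fst p) <= b1) /\ (a2 <= snd (fst p) <= b2)) /\ 0 <= snd p <= T) g)
  as [[[x y] t] [[[Hx Hy] Ht] Hm]]; simpl in *.
- exact (product_compact _ _ (product_compact _ _ (segment_compact a1 b1) (segment_compact a2 b2))
    (segment_compact 0 T)).
- exists ((x1, y1), T); simpl; lra.
- intros p _; unfold g.
  apply (continuous_minus (V := R_NormedModule)); [apply Hc|].
  apply (continuous_scal_r (V := R_NormedModule)).
  destruct p; apply continuous_snd.
- assert (Hm' : forall x' y' s, a1 <= x' <= b1 -> a2 <= y' <= b2 -> 0 <= s <= T ->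
    f x' y' s - e * s <= f x y t - e * t).
  { intros x' y' s Hx' Hy' Hs; specialize (Hm ((x', y'), s)); unfold g in Hm; simpl in Hm.
    rewrite !Rmax_right in Hm by lra; apply Hm; lra. }
  assert (HmT := Hm' x1 y1 T Hx1 Hy1 ltac:(lra)).
  assert (Het : 0 <= e * t) by (apply Rmult_le_pos; lra).
  assert (Ht0 : 0 < t).
  { destruct (proj1 Ht) as [H|<-]; [exact H|].
    specialize (H0 x y Hx Hy); lra. }
  destruct (Hmax x y t Hx Hy Ht0) as [d [Hd Hd0]]; [lra| |].
  { intros x' y' Hx' Hy'; specialize (Hm' x' y' t Hx' Hy' ltac:(lra)); lra. }
  assert (0 <= d - e); [|lra].
  (* The maximum may sit at [t = T], so only earlier times are compared. *)
  apply (is_derive_left_max (fun s => f x y s - e * s) t).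
  + apply (is_derive_minus (V := R_NormedModule)); [exact Hd|].
    auto_derive; auto; ring.
  + exists t; split; [exact Ht0|].
    intros s Hs; apply Hm'; lra.
Qed.

(** * Integrals against z^(-alpha) *)

Lemma derive_lower_bound (f df : R -> R) (a b c : R) :
  a <= b -> (forall x, a <= x <= b -> is_derive f x (df x)) ->
  (forall x, a <= x <= b -> c <= df x) -> c * (b - a) <= f b - f a.
Proof.
intros Hab Hd Hc.
destruct (MVT_gen f a b df) as [x [Hx E]].
- intros x; rewrite Rmin_left, Rmax_right by lra; intros Hx; apply Hd; lra.
- intros x; rewrite Rmin_left, Rmax_right by lra; intros Hx.
  apply continuity_pt_filterlim.
  apply (ex_derive_continuous (K := R_AbsRing) (V := R_NormedModule)).
  eexists; apply Hd; lra.
- rewrite Rmin_left, Rmax_right in Hx by lra; rewrite E.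
  apply Rmult_le_compat_r; [lra|auto].
Qed.

Lemma derive_abs_bound (f df : R -> R) (a b c : R) :
  a <= b -> (forall x, a <= x <= b -> is_derive f x (df x)) ->
  (forall x, a <= x <= b -> Rabs (df x) <= c) -> Rabs (f b - f a) <= c * (b - a).
Proof.
intros Hab Hd Hc; apply Rabs_le; split.
- rewrite Ropp_mult_distr_l; apply (derive_lower_bound f df); auto.
  intros x Hx; specialize (Hc x Hx); apply Rabs_le_between in Hc; lra.
- enough (- c * (b - a) <= - f b - - f a) by lra.
  apply (derive_lower_bound (fun x => - f x) (fun x => - df x)); auto.
  + intros x Hx; apply (is_derive_opp (V := R_NormedModule)); auto.
  + intros x Hx; specialize (Hc x Hx); apply Rabs_le_between in Hc; lra.
Qed.

Lemma derive_zero_constant (f : R -> R) (a b : R) :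
  (forall x, is_derive f x 0) -> f a = f b.
Proof.
enough (W : (forall x, is_derive f x 0) -> forall a b, a <= b -> f a = f b).
{ intros Hd; destruct (Rle_dec a b); [auto|symmetry; apply W; auto; lra]. }
intros Hd x y Hxy.
assert (Hb := derive_abs_bound f (fun _ => 0) x y 0 Hxy (fun z _ => Hd z)
  (fun z _ => Req_le _ _ Rabs_R0)).
rewrite Rmult_0_l in Hb; apply Rabs_le_between in Hb; lra.
Qed.

Lemma Rpower_pos (x a : R) : 0 < Rpower x a.
Proof. apply exp_pos. Qed.

Lemma is_derive_Rpower (a z : R) :
  0 < z -> is_derive (fun z => Rpower z a) z (a * Rpower z (a - 1)).
Proof. intros Hz; apply is_derive_Reals, derivable_pt_lim_power, Hz. Qed.

Lemma Rpower_pred (z a : R) : 0 < z -> Rpower z (a - 1) * z = Rpower z a.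
Proof.
intros Hz; rewrite <- (Rpower_1 z Hz) at 2; rewrite <- Rpower_plus; f_equal; ring.
Qed.

Lemma Rpower_at_infinity (b : R) :
  0 < b -> is_lim_seq (fun n => Rpower (INR n + 3) (- b)) 0.
Proof.
intros Hb; unfold Rpower.
apply (is_lim_comp_seq exp (fun n => - b * ln (INR n + 3)) m_infty 0).
- apply is_lim_exp_m.
- exists O; intros n _; discriminate.
- replace m_infty with (Rbar_mult (- b) p_infty).
  2:{ simpl; destruct (Rle_dec 0 (- b)); [exfalso; lra|reflexivity]. }
  apply is_lim_seq_scal_l.
  apply (is_lim_comp_seq ln _ p_infty p_infty).
  + apply is_lim_ln_p.
  + exists O; intros n _; discriminate.
  + apply (is_lim_seq_plus _ _ p_infty 3 p_infty); [apply is_lim_seq_INR|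
      apply is_lim_seq_const|reflexivity].
Qed.

(** One parameter drives both cut-offs, as in [PV_R] with [e = / (INR n + 3)]. The offset 3 keeps
    [2, 3] inside every window. *)
Definition truncated_integral (alpha : R) (s : R -> R) (n : nat) : R :=
  RInt (fun z => s z * Rpower z (- alpha)) (/ (INR n + 3)) (INR n + 3).

Lemma truncation_bounds (n : nat) :
  3 <= INR n + 3 /\ 0 < / (INR n + 3) <= 1 / 3.
Proof.
assert (Hn := pos_INR n); split; [lra|split; [apply Rinv_0_lt_compat; lra|]].
unfold Rdiv; rewrite Rmult_1_l; apply Rinv_le_contravar; lra.
Qed.

Lemma truncated_integrand_continuous (alpha : R) (s : R -> R) (z : R) :
  continuous s z -> 0 < z -> continuous (fun z => s z * Rpower z (- alpha)) z.
Proof.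
intros Hs Hz; apply (continuous_mult (K := R_AbsRing)); [exact Hs|].
apply (ex_derive_continuous (K := R_AbsRing) (V := R_NormedModule)).
eexists; apply is_derive_Rpower, Hz.
Qed.

Lemma ex_truncated_integral (alpha : R) (s : R -> R) (n : nat) :
  (forall z, continuous s z) ->
  ex_RInt (fun z => s z * Rpower z (- alpha)) (/ (INR n + 3)) (INR n + 3).
Proof.
intros Hs; destruct (truncation_bounds n).
apply (ex_RInt_continuous (V := R_CompleteNormedModule)).
intros z; rewrite Rmin_left, Rmax_right by lra; intros Hz.
apply truncated_integrand_continuous; [auto|lra].
Qed.

Lemma truncated_integral_plus (alpha : R) (s1 s2 : R -> R) (n : nat) :
  (forall z, continuous s1 z) -> (forall z, continuous s2 z) ->
  truncated_integral alpha (fun z => s1 z + s2 z) n =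
  truncated_integral alpha s1 n + truncated_integral alpha s2 n.
Proof.
intros H1 H2; unfold truncated_integral.
rewrite <- (RInt_plus (V := R_CompleteNormedModule)) by (apply ex_truncated_integral; auto).
apply RInt_ext; intros z _; unfold plus; simpl; ring.
Qed.

Lemma truncated_integral_scal (alpha a : R) (s : R -> R) (n : nat) :
  (forall z, continuous s z) ->
  truncated_integral alpha (fun z => a * s z) n = a * truncated_integral alpha s n.
Proof.
intros H1; unfold truncated_integral.
rewrite <- (RInt_scal (V := R_CompleteNormedModule)) by (apply ex_truncated_integral; auto).
apply RInt_ext; intros z _; unfold scal; simpl; unfold mult; simpl; ring.
Qed.

(* -k'''(3) for k(z) = z^(-alpha). *)
Definition kernel_constant (alpha : R) : R :=
  alpha * (alpha + 1) * (alpha + 2) * Rpower 3 (- alpha - 3).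

(* With k(z) = z^(-alpha): k s = (k S - k' T + k'' U)' - k''' U, the boundary
   terms vanish at 0 and at infinity, and k''' < 0. *)
Lemma truncated_integral_limit_ge (alpha : R) (s S T U : R -> R) (B w l : R) :
  0 < alpha < 2 ->
  (forall z, continuous s z) ->
  (forall z, is_derive S z (s z)) ->
  (forall z, is_derive T z (S z)) ->
  (forall z, is_derive U z (T z)) ->
  T 0 = 0 -> U 0 = 0 ->
  (forall z, 0 <= z -> Rabs (S z) <= B /\ Rabs (S z) <= B * z ^ 2) ->
  (forall z, 0 <= z -> 0 <= U z) ->
  0 <= w -> (forall z, 2 <= z <= 3 -> w <= U z) ->
  is_lim_seq (truncated_integral alpha s) l ->
  kernel_constant alpha * w <= l.
Proof.
intros Ha Cs DS DT DU T0 U0 BS PU Pw WU Hl.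
assert (HB : 0 <= B).
{ destruct (BS 0 (Rle_refl 0)) as [H _]; assert (P := Rabs_pos (S 0)); lra. }
set (c2 := alpha * (alpha + 1)); set (c3 := c2 * (alpha + 2)).
assert (Hc2 : 0 < c2) by (unfold c2; nra).
assert (Hc3 : 0 < c3) by (unfold c3; nra).
set (Th := fun z => S z * Rpower z (- alpha) + alpha * (T z * Rpower z (- alpha - 1))
  + c2 * (U z * Rpower z (- alpha - 1 - 1))).
set (W := fun z => c3 * (U z * Rpower z (- alpha - 1 - 1 - 1))).
assert (DTh : forall z, 0 < z -> is_derive Th z (s z * Rpower z (- alpha) - W z)).
{ intros z Hz.
  assert (P1 := is_derive_Rpower (- alpha) z Hz).
  assert (P2 := is_derive_Rpower (- alpha - 1) z Hz).
  assert (P3 := is_derive_Rpower (- alpha - 1 - 1) z Hz).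
  assert (M1 := is_derive_mult _ _ z _ _ (DS z) P1 Rmult_comm).
  assert (M2 := is_derive_mult _ _ z _ _ (DT z) P2 Rmult_comm).
  assert (M3 := is_derive_mult _ _ z _ _ (DU z) P3 Rmult_comm).
  apply (is_derive_scal _ _ alpha) in M2.
  apply (is_derive_scal _ _ c2) in M3.
  assert (M := is_derive_plus (V := R_NormedModule) _ _ z _ _
    (is_derive_plus (V := R_NormedModule) _ _ z _ _ M1 M2) M3).
  match type of M with is_derive _ _ ?v => replace (s z * Rpower z (- alpha) - W z) with v; [exact M|] end.
  unfold W, c3, c2, plus, mult, scal; simpl; unfold mult; simpl; ring. }
(* Both bounds on [S] are integrated from 0, where [T] and [U] vanish. The first serves at the upper
   cut-off, the second at the lower one. *)
assert (BT : forall z, 0 <= z -> Rabs (T z) <= B * z /\ Rabs (T z) <= B * z ^ 2 * z).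
{ intros z Hz; replace (T z) with (T z - T 0) by lra; split.
  - replace (B * z) with (B * (z - 0)) by ring.
    apply (derive_abs_bound T S); auto; intros y Hy; apply BS; lra.
  - replace (B * z ^ 2 * z) with (B * z ^ 2 * (z - 0)) by ring.
    apply (derive_abs_bound T S); auto; intros y Hy.
    destruct (BS y) as [_ H]; [lra|]; apply (Rle_trans _ _ _ H).
    apply Rmult_le_compat_l; [exact HB|]; apply pow_incr; lra. }
assert (BU : forall z, 0 <= z -> Rabs (U z) <= B * z * z /\ Rabs (U z) <= B * z ^ 2 * z * z).
{ intros z Hz; replace (U z) with (U z - U 0) by lra; split.
  - replace (B * z * z) with (B * z * (z - 0)) by ring.
    apply (derive_abs_bound U T); auto; intros y Hy.
    destruct (BT y) as [H _]; [lra|]; apply (Rle_trans _ _ _ H).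
    apply Rmult_le_compat_l; lra.
  - replace (B * z ^ 2 * z * z) with (B * z ^ 2 * z * (z - 0)) by ring.
    apply (derive_abs_bound U T); auto; intros y Hy.
    destruct (BT y) as [_ H]; [lra|]; apply (Rle_trans _ _ _ H).
    assert (y ^ 2 <= z ^ 2) by (apply pow_incr; lra).
    apply Rmult_le_compat; try lra; [assert (0 <= y ^ 2) by apply pow2_ge_0; nra|].
    apply Rmult_le_compat_l; lra. }
set (D := B * (1 + alpha + c2)).
(* Used with [r = B] at the upper cut-off and [r = B * e ^ 2] at the lower one. The boundary terms
   then decay like the powers [- alpha] and [- (2 - alpha)] of the upper cut-off; this is where
   [0 < alpha < 2] enters. *)
assert (BTh : forall z r, 0 < z -> 0 <= r -> Rabs (S z) <= r -> Rabs (T z) <= r * z ->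
  Rabs (U z) <= r * z * z -> Rabs (Th z) <= r * (1 + alpha + c2) * Rpower z (- alpha)).
{ intros z r Hz Hr H1 H2 H3; unfold Th.
  rewrite <- (Rpower_pred z (- alpha)) by exact Hz.
  rewrite <- (Rpower_pred z (- alpha - 1)) by exact Hz.
  set (p := Rpower z (- alpha - 1 - 1)); assert (Hp : 0 < p) by apply Rpower_pos.
  replace (S z * (p * z * z) + alpha * (T z * (p * z)) + c2 * (U z * p)) with
    (p * (S z * (z * z) + alpha * (T z * z) + c2 * U z)) by ring.
  rewrite Rabs_mult, (Rabs_pos_eq p) by lra.
  replace (r * (1 + alpha + c2) * (p * z * z)) with
    (p * (r * (z * z) + alpha * (r * z * z) + c2 * (r * z * z))) by ring.
  apply Rmult_le_compat_l; [lra|].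
  eapply Rle_trans; [apply Rabs_triang|]; apply Rplus_le_compat.
  - eapply Rle_trans; [apply Rabs_triang|].
    rewrite !Rabs_mult, (Rabs_pos_eq z), (Rabs_pos_eq alpha) by lra.
    apply Rplus_le_compat; [apply Rmult_le_compat_r; nra|].
    apply Rmult_le_compat_l; [lra|]; apply Rmult_le_compat_r; lra.
  - rewrite Rabs_mult, (Rabs_pos_eq c2) by lra; apply Rmult_le_compat_l; lra. }
assert (Main : forall n, kernel_constant alpha * w
   - D * Rpower (INR n + 3) (- alpha) - D * Rpower (INR n + 3) (- (2 - alpha))
   <= truncated_integral alpha s n).
{ intros n; destruct (truncation_bounds n) as [HR [He0 He]].
  set (r := INR n + 3) in *; set (e := / r) in *.
  assert (TR : Rabs (Th r) <= D * Rpower r (- alpha)).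
  { apply BTh; try lra; [apply BS|apply BT|apply BU]; lra. }
  assert (Te : Rabs (Th e) <= D * Rpower r (- (2 - alpha))).
  { replace (D * Rpower r (- (2 - alpha))) with
      (B * e ^ 2 * (1 + alpha + c2) * Rpower e (- alpha)).
    - apply BTh; try lra; [|apply BS|apply BT|apply BU]; try lra.
      apply Rmult_le_pos; [lra|apply pow2_ge_0].
    - replace (Rpower r (- (2 - alpha))) with (e ^ 2 * Rpower e (- alpha));
        [unfold D; ring|].
      rewrite <- Rpower_pow by exact He0; rewrite <- Rpower_plus.
      unfold e, Rpower; rewrite ln_Rinv by lra; f_equal; simpl; ring. }
  set (h := fun z => s z * Rpower z (- alpha)).
  set (H := fun z => RInt h e z - Th z).
  assert (Ch : forall z, 0 < z -> continuous h z).
  { intros z Hz; apply truncated_integrand_continuous; auto. }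
  assert (DH : forall z, e <= z -> is_derive H z (W z)).
  { intros z Hz.
    replace (W z) with (minus (h z) (s z * Rpower z (- alpha) - W z))
      by (unfold minus, plus, opp, h; simpl; ring).
    apply (is_derive_minus (V := R_NormedModule)); [|apply DTh; lra].
    apply (is_derive_RInt (V := R_NormedModule) h (RInt h e) e); [|apply Ch; lra].
    exists (mkposreal e He0); intros y Hy.
    apply Rabs_def2 in Hy; unfold minus, plus, opp in Hy; simpl in Hy.
    apply (RInt_correct (V := R_CompleteNormedModule)), (ex_RInt_continuous (V := R_CompleteNormedModule)).
    intros x Hx; apply Ch.
    enough (0 < Rmin e y) by lra; apply Rmin_glb_lt; lra. }
  assert (PW : forall z, e <= z -> 0 <= W z).
  { intros z Hz; unfold W; assert (P := Rpower_pos z (- alpha - 1 - 1 - 1)).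
    assert (0 <= U z) by (apply PU; lra).
    apply Rmult_le_pos; [lra|]; apply Rmult_le_pos; lra. }
  (* [H] is nondecreasing, and only its growth over [2, 3] is kept, where [U] is at least [w] and
     the power of [z] at least its value at 3. *)
  assert (G1 := derive_lower_bound H W e 2 0 ltac:(lra)
    (fun z Hz => DH z (proj1 Hz)) (fun z Hz => PW z (proj1 Hz))).
  assert (G3 := derive_lower_bound H W 3 r 0 ltac:(lra)
    (fun z Hz => DH z ltac:(lra)) (fun z Hz => PW z ltac:(lra))).
  assert (G2 : kernel_constant alpha * w * (3 - 2) <= H 3 - H 2).
  { apply (derive_lower_bound H W); [lra|intros z Hz; apply DH; lra|].
    intros z Hz; unfold W, kernel_constant.
    replace (- alpha - 1 - 1 - 1) with (- alpha - 3) by ring.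
    fold c2; fold c3; rewrite Rmult_assoc; apply Rmult_le_compat_l; [lra|].
    rewrite Rmult_comm; apply Rmult_le_compat;
      [exact Pw|left; apply Rpower_pos|apply WU; exact Hz|].
    replace (- alpha - 3) with (- (alpha + 3)) by ring.
    rewrite !Rpower_Ropp; apply Rinv_le_contravar; [apply Rpower_pos|].
    apply Rle_Rpower_l; lra. }
  assert (HH : H r - H e = truncated_integral alpha s n - Th r + Th e).
  { unfold H, truncated_integral; fold r; fold e; fold h.
    rewrite (RInt_point (V := R_CompleteNormedModule)); unfold zero; simpl; ring. }
  apply Rabs_le_between in TR; apply Rabs_le_between in Te; lra. }
assert (L : is_lim_seq (fun n => kernel_constant alpha * w
   - D * Rpower (INR n + 3) (- alpha) - D * Rpower (INR n + 3) (- (2 - alpha)))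
   (kernel_constant alpha * w - D * 0 - D * 0)).
{ apply is_lim_seq_minus'; [apply is_lim_seq_minus'|].
  - apply is_lim_seq_const.
  - apply (is_lim_seq_scal_l _ D 0), Rpower_at_infinity; lra.
  - apply (is_lim_seq_scal_l _ D 0), Rpower_at_infinity; lra. }
assert (Hle := is_lim_seq_le _ _ _ _ Main L Hl); simpl in Hle; lra.
Qed.

(** * The potential of a classical solution *)

Lemma derive_continuous (f : R -> R) (x d : R) : is_derive f x d -> continuous f x.
Proof.
intros Hd; apply (ex_derive_continuous (K := R_AbsRing) (V := R_NormedModule)).
exists d; exact Hd.
Qed.

Lemma is_derive_shift (f : R -> R) (a z d : R) :
  is_derive f (a + z) d -> is_derive (fun z => f (a + z)) z d.
Proof.
intros Hd; replace d with (scal 1 d) by (unfold scal; simpl; unfold mult; simpl; ring).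
apply (is_derive_comp f (fun z => a + z)); [exact Hd|auto_derive; auto].
Qed.

Lemma is_derive_reflect (f : R -> R) (a z d : R) :
  is_derive f (a - z) d -> is_derive (fun z => f (a - z)) z (- d).
Proof.
intros Hd; replace (- d) with (scal (-1) d) by (unfold scal; simpl; unfold mult; simpl; ring).
apply (is_derive_comp f (fun z => a - z)); [exact Hd|auto_derive; auto; ring].
Qed.

Lemma periodic_shift (f : R -> R) :
  (forall x, f (x + 1) = f x) -> forall n x, f (x + IZR n) = f x.
Proof.
intros Hp.
assert (HN : forall n x, f (x + INR n) = f x).
{ induction n as [|n IH]; intros x; [simpl; f_equal; ring|].
  rewrite S_INR, <- Rplus_assoc, Hp; apply IH. }
intros n x; destruct (Z_le_gt_dec 0 n) as [H|H].
- rewrite <- (Z2Nat.id n H), <- INR_IZR_INZ; apply HN.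
- rewrite <- (HN (Z.to_nat (- n)) (x + IZR n)), INR_IZR_INZ, Z2Nat.id by lia.
  rewrite opp_IZR; f_equal; ring.
Qed.

Lemma periodic_reduce (f : R -> R) (x : R) :
  (forall x, f (x + 1) = f x) -> exists y, 0 <= y <= 1 /\ f x = f y.
Proof.
intros Hp; exists (frac_part x); split.
- destruct (base_fp x); lra.
- rewrite <- (periodic_shift f Hp (Int_part x) (frac_part x)).
  f_equal; unfold frac_part; ring.
Qed.

Lemma derive_lipschitz (f df : R -> R) (a b c : R) :
  (forall x, Rmin a b <= x <= Rmax a b -> is_derive f x (df x)) ->
  (forall x, Rmin a b <= x <= Rmax a b -> Rabs (df x) <= c) ->
  Rabs (f b - f a) <= c * Rabs (b - a).
Proof.
destruct (Rle_dec a b) as [H|H].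
- rewrite Rmin_left, Rmax_right, (Rabs_pos_eq (b - a)) by lra.
  apply derive_abs_bound, H.
- rewrite Rmin_right, Rmax_left by lra.
  rewrite (Rabs_minus_sym (f b)), (Rabs_minus_sym b), (Rabs_pos_eq (a - b)) by lra.
  apply derive_abs_bound; lra.
Qed.

Lemma integral_eq_is_RInt (f : R -> R) (a b v : R) : integral_eq f a b v -> is_RInt f a b v.
Proof.
intros [pr E]; rewrite <- E, <- RInt_Reals.
apply (RInt_correct (V := R_CompleteNormedModule)), ex_RInt_Reals_1, pr.
Qed.

(** The integrand is nonnegative, hence so is its principal value [l], and [c * l = 1] leaves only a
    positive [c]. *)
Lemma c_alpha_positive (alpha c : R) : c_alpha_spec alpha c -> 0 < c.
Proof.
intros [l [HPV Hc]].
assert (Hl : 0 <= l).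
{ apply Rnot_lt_le; intros Hneg.
  destruct (HPV (- l)) as [d [Hd H]]; [lra|].
  (* Staying below 1 gives [e < / e], so the bounds of both integrals are in increasing order. *)
  set (e := Rmin d 1 / 2).
  assert (P := Rmin_pos d 1 Hd Rlt_0_1); assert (Ql := Rmin_l d 1); assert (Qr := Rmin_r d 1).
  assert (He : 0 < e < d /\ e < 1) by (unfold e; lra).
  assert (Hie : 1 < / e) by (rewrite <- Rinv_1; apply Rinv_lt_contravar; lra).
  destruct (H e (proj1 He)) as [v1 [v2 [I1 [I2 Hv]]]].
  assert (Pf : forall y, 0 <= (1 - cos y) / Rpower (Rabs y) (1 + alpha)).
  { intros y; apply Rmult_le_pos; [destruct (COS_bound y); lra|].
    left; apply Rinv_0_lt_compat, exp_pos. }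
  apply integral_eq_is_RInt in I1; apply integral_eq_is_RInt in I2.
  assert (P1 : 0 <= v1).
  { rewrite <- (is_RInt_unique (V := R_CompleteNormedModule) _ _ _ _ I1); apply RInt_ge_0;
      [lra|eexists; exact I1|auto]. }
  assert (P2 : 0 <= v2).
  { rewrite <- (is_RInt_unique (V := R_CompleteNormedModule) _ _ _ _ I2); apply RInt_ge_0;
      [lra|eexists; exact I2|auto]. }
  apply Rabs_def2 in Hv; lra. }
apply Rnot_le_lt; intros Hc0; nra.
Qed.

(** The substitutions y = x - z and y = x + z fold both halves onto z > 0. The factor [sgn] gives
    them opposite signs, so the terms [r x] cancel and the opposite of the truncated integral
    remains. *)
Lemma principal_value_limit (alpha : R) (r : R -> R) (x l : R) :
  PV_R (fun y => (r y - r x) / (sgn (x - y) * Rpower (Rabs (x - y)) alpha)) x l ->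
  is_lim_seq (truncated_integral alpha (fun z => r (x + z) - r (x - z))) (- l).
Proof.
intros HPV; apply is_lim_seq_Reals; intros eps Heps.
destruct (HPV eps Heps) as [d [Hd H]].
destruct (INR_unbounded (/ d)) as [N HN].
exists N; intros n Hn; apply le_INR in Hn.
destruct (truncation_bounds n) as [HR [He0 He]].
assert (Hdi := Rinv_0_lt_compat d Hd).
assert (Hed : / (INR n + 3) < d).
{ rewrite <- (Rinv_inv d); apply Rinv_lt_contravar; [apply Rmult_lt_0_compat|]; lra. }
destruct (H _ (conj He0 Hed)) as [v1 [v2 [I1 [I2 Hv]]]].
rewrite Rinv_inv in I1, I2.
unfold truncated_integral.
set (R0 := INR n + 3) in *; set (e := / R0) in *.
set (f := fun y => (r y - r x) / (sgn (x - y) * Rpower (Rabs (x - y)) alpha)) in *.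
apply integral_eq_is_RInt in I1; apply integral_eq_is_RInt in I2.
replace (x - R0) with (-1 * R0 + x) in I1 by ring.
replace (x - e) with (-1 * e + x) in I1 by ring.
replace (x + R0) with (1 * R0 + x) in I2 by ring.
replace (x + e) with (1 * e + x) in I2 by ring.
apply (is_RInt_comp_lin (V := R_NormedModule)) in I1.
apply (is_RInt_comp_lin (V := R_NormedModule)) in I2.
(* The substitution of slope -1 has exchanged the bounds. *)
apply (is_RInt_swap (V := R_NormedModule)) in I1.
assert (I := is_RInt_minus (V := R_NormedModule) _ _ _ _ _ _ I1 I2).
assert (E : RInt (fun z => (r (x + z) - r (x - z)) * Rpower z (- alpha)) e R0 = - (v1 + v2)).
{ replace (- (v1 + v2)) with (minus (opp v1) v2)
    by (unfold minus, plus, opp; simpl; ring).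
  apply (is_RInt_unique (V := R_CompleteNormedModule)).
  eapply (is_RInt_ext (V := R_NormedModule)); [|exact I].
  intros z; rewrite Rmin_left, Rmax_right by lra; intros Hz.
  unfold minus, plus, opp, scal; simpl; unfold mult; simpl; unfold f.
  replace (x - (-1 * z + x)) with z by ring; replace (x - (1 * z + x)) with (- z) by ring.
  replace (-1 * z + x) with (x - z) by ring; replace (1 * z + x) with (x + z) by ring.
  rewrite Rabs_Ropp, (Rabs_pos_eq z) by lra.
  unfold sgn; destruct (Rlt_dec 0 z) as [_|Hn1]; [|lra].
  destruct (Rlt_dec 0 (- z)) as [Hn1|_]; [lra|].
  destruct (Rlt_dec (- z) 0) as [_|Hn1]; [|lra].
  rewrite Rpower_Ropp; assert (P := Rpower_pos z alpha); field; lra. }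
unfold Rdist; rewrite E.
replace (- (v1 + v2) - - l) with (- (v1 + v2 - l)) by ring.
rewrite Rabs_Ropp; exact Hv.
Qed.

(** The interface between the regularity theory and the comparison arguments. The flux at 0 in
    [potential_dt] comes from normalising [F] at 0; it cancels in combinations of values of [F] of
    total weight zero. The two bounds in [potential_second_difference] control the boundary terms of
    the integrations by parts. *)
Record flow_potential (alpha c m : R) (rho u F : R -> R -> R) : Prop := {
  density_periodic : forall x t, 0 <= t -> rho (x + 1) t = rho x t;
  density_derivable : forall x t, 0 <= t -> ex_derive (fun y => rho y t) x;
  potential_0 : forall t, F 0 t = 0;
  potential_periodic : forall x t, 0 <= t -> F (x + 1) t = F x t + m;
  potential_dx : forall x t, 0 <= t -> is_derive (fun y => F y t) x (rho x t);
  potential_dt : forall x t, 0 < t ->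
    is_derive (fun s => F x s) t (rho 0 t * u 0 t - rho x t * u x t);
  potential_continuous : forall p : R * R,
    continuous (fun p : R * R => F (fst p) (Rmax 0 (snd p))) p;
  potential_second_difference : forall t, 0 <= t -> exists B, forall x z, 0 <= z ->
    Rabs (F (x + z) t + F (x - z) t - 2 * F x t) <= B /\
    Rabs (F (x + z) t + F (x - z) t - 2 * F x t) <= B * z ^ 2;
  velocity_limit : forall x t, 0 <= t ->
    is_lim_seq (fun n =>
      c * truncated_integral alpha (fun z => rho (x + z) t - rho (x - z) t) n) (- u x t) }.

Lemma Rmax_0_nonneg (t : R) : 0 <= Rmax 0 t.
Proof. apply Rmax_l. Qed.

Lemma cont2_on_continuity_2d (f : R -> R -> R) (x t : R) :
  cont2_on f (fun _ t => 0 <= t) -> continuity_2d_pt (fun x t => f x (Rmax 0 t)) x t.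
Proof.
intros Hf eps.
destruct (Hf x (Rmax 0 t) (Rmax_0_nonneg t) eps (cond_pos eps)) as [d [Hd H]].
exists (mkposreal d Hd); simpl; intros y s Hy Hs.
apply H; [apply Rmax_0_nonneg|exact Hy|].
eapply Rle_lt_trans; [|exact Hs].
unfold Rmax; destruct (Rle_dec 0 s), (Rle_dec 0 t); unfold Rabs;
  repeat destruct Rcase_abs; lra.
Qed.

(** The periodic function [dr] is bounded by some [L], so the derivative [r (x + z) - r (x - z)] of
    the second difference is at most [2 * L * z]; this gives the quadratic bound. The second
    difference is 1-periodic in [z], the increments [m] cancelling, so its values for [z] in [0, 1]
    bound it everywhere. *)
Lemma second_difference_bound (r dr F : R -> R) (m : R) :
  (forall x, r (x + 1) = r x) ->
  (forall x, is_derive r x (dr x)) -> (forall x, continuous dr x) ->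
  (forall x, is_derive F x (r x)) -> (forall x, F (x + 1) = F x + m) ->
  exists B, forall x z, 0 <= z ->
    Rabs (F (x + z) + F (x - z) - 2 * F x) <= B /\
    Rabs (F (x + z) + F (x - z) - 2 * F x) <= B * z ^ 2.
Proof.
intros Pr Dr Cdr DF PF.
assert (Pdr : forall x, dr (x + 1) = dr x).
{ intros x; rewrite <- (is_derive_unique _ _ _ (Dr x)).
  symmetry; apply is_derive_unique.
  apply (is_derive_ext (fun y => r (1 + y))); [intros y; rewrite Rplus_comm; apply Pr|].
  apply is_derive_shift; rewrite Rplus_comm; apply Dr. }
destruct (compact_max (X := R_UniformSpace) (fun x => 0 <= x <= 1) (fun x => Rabs (dr x)))
  as [x0 [_ Hx0]].
- apply segment_compact.
- exists 0; lra.
- intros x _; apply (continuous_comp dr Rabs); [apply Cdr|].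
  apply continuity_pt_filterlim, Rcontinuity_abs.
- set (L := Rabs (dr x0)) in *.
  assert (HL : forall x, Rabs (dr x) <= L).
  { intros x; destruct (periodic_reduce dr x Pdr) as [y [Hy ->]]; auto. }
  assert (HL0 : 0 <= L) by apply Rabs_pos.
  exists (2 * L).
  assert (Q : forall x z, 0 <= z -> Rabs (F (x + z) + F (x - z) - 2 * F x) <= 2 * L * z ^ 2).
  { intros x z Hz.
    replace (F (x + z) + F (x - z) - 2 * F x) with
      ((F (x + z) + F (x - z)) - (F (x + 0) + F (x - 0)))
      by (rewrite Rplus_0_r, Rminus_0_r; ring).
    replace (2 * L * z ^ 2) with (2 * L * z * (z - 0)) by ring.
    apply (derive_abs_bound (fun z => F (x + z) + F (x - z)) (fun z => r (x + z) + - r (x - z)));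
      [exact Hz| |].
    - intros y _; apply (is_derive_plus (V := R_NormedModule));
        [apply is_derive_shift, DF|apply is_derive_reflect, DF].
    - intros y Hy.
      assert (H := derive_abs_bound r dr (x - y) (x + y) L ltac:(lra)
        (fun w _ => Dr w) (fun w _ => HL w)).
      replace (r (x + y) + - r (x - y)) with (r (x + y) - r (x - y)) by ring.
      apply (Rle_trans _ _ _ H); nra. }
  intros x z Hz; split; [|apply Q, Hz].
  destruct (periodic_reduce (fun z => F (x + z) + F (x - z) - 2 * F x) z) as [y [Hy ->]].
  + intros w; replace (x + (w + 1)) with ((x + w) + 1) by ring.
    replace (x - w) with ((x - (w + 1)) + 1) by ring; rewrite !PF; ring.
  + apply (Rle_trans _ _ _ (Q x y (proj1 Hy))).
    rewrite <- (Rmult_1_r (2 * L)) at 2; apply Rmult_le_compat_l; [lra|].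
    rewrite <- (pow1 2); apply pow_incr, Hy.
Qed.

Lemma is_derive_integral (f : R -> R) (x : R) :
  (forall y, continuous f y) -> is_derive (fun x => RInt f 0 x) x (f x).
Proof.
intros Cf; apply (is_derive_RInt (V := R_NormedModule) f (RInt f 0) 0); [|apply Cf].
apply filter_forall; intros y.
apply (RInt_correct (V := R_CompleteNormedModule)),
  (ex_RInt_continuous (V := R_CompleteNormedModule)); auto.
Qed.

(** The increment is split into a change of time at fixed [x], small by uniform continuity of [h] on
    a rectangle, and a change of [x] at time [t0], small because the integral is differentiable in
    [x]. *)
Lemma density_integral_continuous (h : R -> R -> R) (p : R * R) :
  (forall x t, continuity_2d_pt h x t) ->
  continuous (fun p : R * R => RInt (fun y => h y (snd p)) 0 (fst p)) p.
Proof.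
intros Hc; destruct p as [x0 t0].
assert (Cx : forall t x, continuous (fun y => h y t) x).
{ intros t x P [d HP]; specialize (Hc x t d) as [e He].
  exists e; intros y Hy; apply HP, (He y t); [exact Hy|].
  rewrite Rminus_diag, Rabs_R0; apply cond_pos. }
assert (DG : forall t x, is_derive (fun x => RInt (fun y => h y t) 0 x) x (h x t)).
{ intros t x; apply (is_derive_integral (fun y => h y t)), Cx. }
apply (continuity_2d_pt_filterlim (fun x t => RInt (fun y => h y t) 0 x) x0 t0).
intros eps.
(* The bound [N] holds for every upper limit within 1 of [x0]; a tolerance [eps / (2 * N)] on [h]
   thus costs at most [eps / 2] after integration. *)
set (N := Rabs x0 + 1).
assert (HN : 1 <= N) by (unfold N; assert (P := Rabs_pos x0); lra).
assert (Heps := cond_pos eps).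
assert (He2 : 0 < eps / (2 * N)) by (apply Rdiv_lt_0_compat; lra).
destruct (uniform_continuity_2d h (- N) N (t0 - 1) (t0 + 1)
  (fun x t _ _ => Hc x t) (mkposreal _ He2)) as [d1 Hd1]; simpl in Hd1.
assert (Hder := derive_continuous _ _ _ (DG t0 x0)).
destruct (Hder (fun v => Rabs (v - RInt (fun y => h y t0) 0 x0) < eps / 2)) as [d2 Hd2].
{ exists (pos_div_2 eps); intros v Hv; exact Hv. }
assert (Hd : 0 < Rmin 1 (Rmin d1 d2)) by (repeat apply Rmin_pos; try apply cond_pos; lra).
exists (mkposreal _ Hd); simpl; intros x t Hx Ht.
assert (Q1 := Rmin_l 1 (Rmin d1 d2)); assert (Q2 := Rmin_r 1 (Rmin d1 d2)).
assert (Q3 := Rmin_l d1 d2); assert (Q4 := Rmin_r d1 d2).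
assert (H2 : Rabs (RInt (fun y => h y t0) 0 x - RInt (fun y => h y t0) 0 x0) < eps / 2).
{ apply Hd2; unfold ball; simpl; unfold AbsRing_ball, abs, minus, plus, opp; simpl; unfold Rminus in Hx; lra. }
assert (HxN : Rabs x <= N).
{ unfold N; replace x with (x0 + (x - x0)) by ring.
  eapply Rle_trans; [apply Rabs_triang|]; lra. }
assert (H1 : Rabs (RInt (fun y => h y t) 0 x - RInt (fun y => h y t0) 0 x) <= eps / 2).
{ assert (H := derive_lipschitz
    (fun x => RInt (fun y => h y t) 0 x - RInt (fun y => h y t0) 0 x)
    (fun x => h x t - h x t0) 0 x (eps / (2 * N))).
  cbv beta in H.
  rewrite !(RInt_point (V := R_CompleteNormedModule)) in H.
  unfold zero in H; simpl in H; rewrite !Rminus_0_r in H.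
  eapply Rle_trans; [apply H|].
  - intros y _; apply (is_derive_minus (V := R_NormedModule)); apply DG.
  - intros y Hy; left.
    apply Rabs_def2 in Ht; apply Rabs_le_between in HxN.
    assert (HyN : - N <= y <= N).
    { unfold Rmin, Rmax in Hy; destruct (Rle_dec 0 x); lra. }
    apply Hd1; try lra.
    + rewrite Rminus_diag, Rabs_R0; apply cond_pos.
    + apply Rabs_def1; lra.
  - replace (eps / 2) with (eps / (2 * N) * N) by (field; lra).
    apply Rmult_le_compat_l; lra. }
replace (RInt (fun y => h y t) 0 x - RInt (fun y => h y t0) 0 x0) with
  ((RInt (fun y => h y t) 0 x - RInt (fun y => h y t0) 0 x) +
   (RInt (fun y => h y t0) 0 x - RInt (fun y => h y t0) 0 x0)) by ring.
eapply Rle_lt_trans; [apply Rabs_triang|]; lra.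
Qed.

(** The evolution of [F] comes from differentiating under the integral and integrating the equation
    in [x]. That [F] grows by the same [m] over a period at all times is conservation of mass. *)
Lemma classical_flow_potential (alpha c m : R) (rho0 : R -> R) (rho u : R -> R -> R) :
  integral_eq rho0 (- (1 / 2)) (1 / 2) m ->
  classical_solution rho0 rho u ->
  velocity_formula alpha c rho u ->
  flow_potential alpha c m rho u (fun x t => RInt (fun y => rho y t) 0 x).
Proof.
intros Hm [Pr [Hr0 [rx [rt [gx [Drx [Drt [Dg [Heq [Cr [Crx Crt]]]]]]]]]]] Hu.
assert (Drx' : forall x t, 0 <= t -> is_derive (fun y => rho y t) x (rx x t)).
{ intros x t Ht; apply is_derive_Reals, Drx, Ht. }
assert (Cx : forall t x, 0 <= t -> continuous (fun y => rho y t) x).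
{ intros t x Ht; exact (derive_continuous _ _ _ (Drx' x t Ht)). }
assert (DF : forall x t, 0 <= t -> is_derive (fun x => RInt (fun y => rho y t) 0 x) x (rho x t)).
{ intros x t Ht; apply (is_derive_integral (fun y => rho y t)); intros y; apply Cx, Ht. }
assert (Vel : forall x t, 0 <= t -> is_lim_seq (fun n =>
      c * truncated_integral alpha (fun z => rho (x + z) t - rho (x - z) t) n) (- u x t)).
{ intros x t Ht; destruct (Hu x t Ht) as [l [Hl ->]].
  apply (principal_value_limit alpha (fun y => rho y t)) in Hl.
  apply (is_lim_seq_scal_l _ c) in Hl; simpl in Hl.
  replace (- (c * l)) with (c * - l) by ring; exact Hl. }
(* The truncated integrals at [x] and [x + 1] coincide, and a limit is unique. *)
assert (Pu : forall x t, 0 <= t -> u (x + 1) t = u x t).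
{ intros x t Ht; apply Ropp_eq_reg, Rbar_finite_eq.
  rewrite <- (is_lim_seq_unique _ _ (Vel (x + 1) t Ht)).
  rewrite <- (is_lim_seq_unique _ _ (Vel x t Ht)).
  apply Lim_seq_ext; intros n; f_equal; apply RInt_ext; intros z _.
  replace (x + 1 + z) with (x + z + 1) by ring.
  replace (x + 1 - z) with (x - z + 1) by ring.
  rewrite !Pr by exact Ht; reflexivity. }
assert (Crt_x : forall x t, 0 < t -> continuous (fun y => rt y t) x).
{ intros x t Ht P [d HP]; destruct (Crt x t Ht d (cond_pos d)) as [e [He H]].
  exists (mkposreal e He); intros y Hy; apply HP, H; [exact Ht|exact Hy|].
  rewrite Rminus_diag, Rabs_R0; exact He. }
assert (Dt : forall x t, 0 < t ->
    is_derive (fun s => RInt (fun y => rho y s) 0 x) t (rho 0 t * u 0 t - rho x t * u x t)).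
{ intros x t Ht.
  assert (Ed : forall y s, 0 < s -> Derive (fun z => rho y z) s = rt y s).
  { intros y s Hs; apply is_derive_unique, is_derive_Reals, Drt, Hs. }
  replace (rho 0 t * u 0 t - rho x t * u x t) with
    (RInt (fun y => Derive (fun s => rho y s) t) 0 x).
  - apply (is_derive_RInt_param (fun s y => rho y s)).
    + exists (mkposreal t Ht); intros s Hs y _; exists (rt y s).
      apply is_derive_Reals, Drt; apply Rabs_def2 in Hs.
      unfold minus, plus, opp in Hs; simpl in Hs; lra.
    + intros y _ eps.
      destruct (Crt y t Ht eps (cond_pos eps)) as [d [Hd H]].
      assert (Hdt : 0 < Rmin d t) by (apply Rmin_pos; lra).
      exists (mkposreal _ Hdt); simpl; intros s z Hs Hz.
      assert (Q1 := Rmin_l d t); assert (Q2 := Rmin_r d t).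
      assert (Hs' := Rabs_def2 _ _ Hs).
      rewrite !Ed by lra; apply H; lra.
    + exists (mkposreal t Ht); intros s Hs.
      apply Rabs_def2 in Hs; unfold minus, plus, opp in Hs; simpl in Hs.
      apply (ex_RInt_continuous (V := R_CompleteNormedModule)); intros y _; apply Cx; lra.
  - rewrite (RInt_ext _ (fun y => rt y t)) by (intros y _; apply Ed, Ht).
    apply (is_RInt_unique (V := R_CompleteNormedModule)).
    replace (rho 0 t * u 0 t - rho x t * u x t) with
      (minus (- (rho x t * u x t)) (- (rho 0 t * u 0 t)))
      by (unfold minus, plus, opp; simpl; ring).
    apply (is_RInt_derive (V := R_CompleteNormedModule) (fun y => - (rho y t * u y t))).
    + intros y _; replace (rt y t) with (- gx y t) by (specialize (Heq y t Ht); lra).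
      apply (is_derive_opp (V := R_NormedModule)), is_derive_Reals, Dg, Ht.
    + intros y _; apply Crt_x, Ht. }
assert (CF : forall p : R * R,
  continuous (fun p : R * R => RInt (fun y => rho y (Rmax 0 (snd p))) 0 (fst p)) p).
{ intros p; apply (density_integral_continuous (fun y s => rho y (Rmax 0 s))).
  intros x t; apply (cont2_on_continuity_2d rho), Cr. }
assert (Per : forall x y t, 0 <= t ->
  RInt (fun y => rho y t) 0 (x + 1) - RInt (fun y => rho y t) 0 x =
  RInt (fun y => rho y t) 0 (y + 1) - RInt (fun y => rho y t) 0 y).
{ intros x y t Ht.
  apply (derive_zero_constant
    (fun x => RInt (fun y => rho y t) 0 (x + 1) - RInt (fun y => rho y t) 0 x)).
  intros w.
  assert (E0 : minus (rho (w + 1) t) (rho w t) = 0)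
    by (rewrite Pr by exact Ht; unfold minus, plus, opp; simpl; ring).
  refine (eq_ind _ (fun d => is_derive _ w d) _ _ E0).
  apply (is_derive_minus (V := R_NormedModule)); [|apply DF, Ht].
  apply (is_derive_ext (fun x => RInt (fun y => rho y t) 0 (1 + x)));
    [intros s; rewrite Rplus_comm; reflexivity|].
  apply (is_derive_shift (fun x => RInt (fun y => rho y t) 0 x)).
  rewrite Rplus_comm; apply DF, Ht. }
(* The mass is given over [-1/2, 1/2]; by [Per] every interval of length 1 carries the same mass. *)
assert (M0 : RInt (fun y => rho y 0) 0 1 = m).
{ assert (E := Per 0 (- (1 / 2)) 0 (Rle_refl 0)).
  replace (0 + 1) with 1 in E by ring; replace (- (1 / 2) + 1) with (1 / 2) in E by lra.
  rewrite (RInt_point (V := R_CompleteNormedModule)) in E; unfold zero in E; simpl in E.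
  rewrite Rminus_0_r in E; rewrite E.
  apply integral_eq_is_RInt in Hm.
  apply (is_RInt_ext (V := R_NormedModule) _ (fun y => rho y 0)) in Hm;
    [|intros y _; symmetry; apply Hr0].
  apply (is_RInt_unique (V := R_CompleteNormedModule)) in Hm; rewrite <- Hm.
  assert (EX : forall a b, ex_RInt (fun y => rho y 0) a b).
  { intros a b; apply (ex_RInt_continuous (V := R_CompleteNormedModule)); intros y _; apply Cx; lra. }
  assert (Ch := RInt_Chasles (V := R_CompleteNormedModule) _ _ _ _
    (EX 0 (- (1 / 2))) (EX (- (1 / 2)) (1 / 2))).
  unfold plus in Ch; simpl in Ch; lra. }
(* By periodicity the fluxes at 0 and 1 agree. The equation holds at positive times only, and the
   mean value theorem on [0, t] asks for mere continuity at time 0. *)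
assert (M : forall t, 0 <= t -> RInt (fun y => rho y t) 0 1 = m).
{ intros t Ht; destruct (Rle_lt_or_eq_dec 0 t Ht) as [Ht0|<-]; [|exact M0].
  destruct (MVT_gen (fun s => RInt (fun y => rho y (Rmax 0 s)) 0 1) 0 t (fun _ => 0))
    as [w [_ E]].
  - rewrite Rmin_left, Rmax_right by lra; intros s Hs.
    apply (is_derive_ext_loc (fun s => RInt (fun y => rho y s) 0 1)).
    + exists (mkposreal s (proj1 Hs)); intros z Hz.
      apply Rabs_def2 in Hz; unfold minus, plus, opp in Hz; simpl in Hz.
      rewrite Rmax_right by lra; reflexivity.
    + assert (H := Dt 1 s (proj1 Hs)).
      assert (E1 := Pr 0 s ltac:(lra)); assert (E2 := Pu 0 s ltac:(lra)).
      rewrite Rplus_0_l in E1, E2; rewrite E1, E2, Rminus_diag in H; exact H.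
  - intros s _; apply continuity_pt_filterlim.
    apply (continuous_comp_2 (fun _ => 1) (fun s => s)
      (fun x s => RInt (fun y => rho y (Rmax 0 s)) 0 x)).
    + apply continuous_const.
    + apply continuous_id.
    + apply CF.
  - rewrite (Rmax_right 0 t), (Rmax_left 0 0), M0 in E by lra; lra. }
assert (PF : forall x t, 0 <= t ->
  RInt (fun y => rho y t) 0 (x + 1) = RInt (fun y => rho y t) 0 x + m).
{ intros x t Ht; assert (E := Per x 0 t Ht).
  replace (0 + 1) with 1 in E by ring; rewrite M in E by exact Ht.
  rewrite (RInt_point (V := R_CompleteNormedModule)) in E; unfold zero in E; simpl in E; lra. }
constructor; auto.
- intros x t Ht; eexists; apply Drx', Ht.
- intros t; apply (RInt_point (V := R_CompleteNormedModule)).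
- intros t Ht.
  apply (second_difference_bound (fun y => rho y t) (fun y => rx y t)
    (fun x => RInt (fun y => rho y t) 0 x) m); auto.
  intros x P [d HP]; destruct (Crx x t Ht d (cond_pos d)) as [e [He H]].
  exists (mkposreal e He); intros y Hy; apply HP, H; [exact Ht|exact Hy|].
  rewrite Rminus_diag, Rabs_R0; exact He.
Qed.

(** * Propagation of symmetry and monotonicity *)

Lemma is_derive_combination (f1 f2 f3 : R -> R) (e1 e2 e3 x d1 d2 d3 : R) :
  is_derive f1 x d1 -> is_derive f2 x d2 -> is_derive f3 x d3 ->
  is_derive (fun y => e1 * f1 y + e2 * f2 y + e3 * f3 y) x (e1 * d1 + e2 * d2 + e3 * d3).
Proof.
intros D1 D2 D3; apply (is_derive_plus (V := R_NormedModule));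
  [apply (is_derive_plus (V := R_NormedModule))|]; apply is_derive_scal; assumption.
Qed.

Lemma is_derive_symmetric_sum (f : R -> R) (a z d1 d2 : R) :
  is_derive f (a + z) d1 -> is_derive f (a - z) d2 ->
  is_derive (fun z => f (a + z) + f (a - z)) z (d1 - d2).
Proof.
intros D1 D2; apply (is_derive_plus (V := R_NormedModule));
  [apply is_derive_shift|apply is_derive_reflect]; assumption.
Qed.

Lemma is_derive_symmetric_difference (f : R -> R) (a z d1 d2 : R) :
  is_derive f (a + z) d1 -> is_derive f (a - z) d2 ->
  is_derive (fun z => f (a + z) - f (a - z)) z (d1 + d2).
Proof.
intros D1 D2; replace (d1 + d2) with (minus d1 (- d2))
  by (unfold minus, plus, opp; simpl; ring).
apply (is_derive_minus (V := R_NormedModule));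
  [apply is_derive_shift|apply is_derive_reflect]; assumption.
Qed.

Lemma is_derive_second_difference (f df : R -> R) (x z : R) :
  (forall y, is_derive f y (df y)) ->
  is_derive (fun z => f (x + z) + f (x - z) - 2 * f x) z (df (x + z) - df (x - z)).
Proof.
intros Df; rewrite <- (Rminus_0_r (df (x + z) - df (x - z))).
apply (is_derive_minus (V := R_NormedModule)).
- apply is_derive_symmetric_sum; apply Df.
- apply (is_derive_const (V := R_NormedModule)).
Qed.

Lemma is_derive_second_difference_center (f df : R -> R) (x z : R) :
  (forall y, is_derive f y (df y)) ->
  is_derive (fun x => f (x + z) + f (x - z) - 2 * f x) x (df (x + z) + df (x - z) - 2 * df x).
Proof.
intros Df; apply (is_derive_minus (V := R_NormedModule));
  [apply (is_derive_plus (V := R_NormedModule))|apply is_derive_scal, Df].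
- apply (is_derive_ext (fun x => f (z + x))); [intros y; f_equal; ring|].
  apply is_derive_shift; rewrite Rplus_comm; apply Df.
- apply (is_derive_ext (fun x => f (- z + x))); [intros y; f_equal; ring|].
  apply is_derive_shift; replace (- z + x) with (x - z) by ring; apply Df.
Qed.

(* T(z) = q2(a+z) - q2(a-z) + 2 mu z is the integral of q1 + mu over [a-z, a+z];
   on [0, 1/2] it is nonnegative because the parts of that interval outside
   [0, 1/2] cancel by oddness about 0 and 1/2. For larger z, the difference
   between its primitive and mu z^2 is even and 1-periodic. *)
Lemma odd_periodic_second_primitive (q1 q2 q3 : R -> R) (a mu : R) :
  (forall x, is_derive q2 x (q1 x)) -> (forall x, is_derive q3 x (q2 x)) ->
  (forall x, q1 (- x) = - q1 x) -> (forall x, q1 (x + 1) = q1 x) ->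
  0 <= mu -> 0 <= a <= 1 / 2 -> (forall x, 0 <= x <= 1 / 2 -> - mu <= q1 x) ->
  forall z, 0 <= z -> 0 <= q3 (a + z) + q3 (a - z) - 2 * q3 a + mu * z ^ 2.
Proof.
intros D2 D3 Od Per Hmu Ha Hq.
assert (Ev : forall x, q2 (- x) = q2 x).
{ intros x; enough (E : q2 (0 + x) - q2 (0 - x) = q2 (0 + 0) - q2 (0 - 0)).
  { rewrite Rplus_0_l, Rminus_0_l in E; rewrite Rplus_0_r, Rminus_0_r in E; lra. }
  apply (derive_zero_constant (fun x => q2 (0 + x) - q2 (0 - x))); intros y.
  assert (E0 : q1 (0 + y) + q1 (0 - y) = 0)
    by (rewrite Rplus_0_l, Rminus_0_l, Od; ring).
  refine (eq_ind _ (fun d => is_derive _ y d) _ _ E0).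
  apply is_derive_symmetric_difference; apply D2. }
assert (P2 : forall x, q2 (x + 1) = q2 x).
(* The constant difference is read off at -1/2, where evenness makes it vanish. *)
{ intros x; enough (E : q2 (1 + x) - q2 (0 + x) = q2 (1 + - (1 / 2)) - q2 (0 + - (1 / 2))).
  { rewrite (Rplus_comm 1 x), !Rplus_0_l in E.
    rewrite (Ev (1 / 2)) in E; replace (1 + - (1 / 2)) with (1 / 2) in E by lra; lra. }
  apply (derive_zero_constant (fun x => q2 (1 + x) - q2 (0 + x))); intros y.
  assert (E0 : minus (q1 (1 + y)) (q1 (0 + y)) = 0)
    by (rewrite Rplus_0_l, Rplus_comm, Per; unfold minus, plus, opp; simpl; ring).
  refine (eq_ind _ (fun d => is_derive _ y d) _ _ E0).
  apply (is_derive_minus (V := R_NormedModule)); apply is_derive_shift, D2. }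
set (v := fun z => q3 (a + z) + q3 (a - z) - 2 * q3 a).
assert (Dv : forall z, is_derive v z (q2 (a + z) - q2 (a - z))).
{ intros z; apply is_derive_second_difference, D3. }
assert (Evv : forall z, v (- z) = v z).
{ intros z; unfold v; replace (a + - z) with (a - z) by ring;
    replace (a - - z) with (a + z) by ring; ring. }
assert (Pv : forall z, v (z + 1) = v z).
{ intros z; enough (E : v (1 + z) - v (0 + z) = v (1 + - (1 / 2)) - v (0 + - (1 / 2))).
  { rewrite (Rplus_comm 1 z), !Rplus_0_l in E.
    rewrite (Evv (1 / 2)) in E; replace (1 + - (1 / 2)) with (1 / 2) in E by lra; lra. }
  apply (derive_zero_constant (fun z => v (1 + z) - v (0 + z))); intros y.
  assert (E0 : minus (q2 (a + (1 + y)) - q2 (a - (1 + y)))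
    (q2 (a + (0 + y)) - q2 (a - (0 + y))) = 0).
  { replace (a + (1 + y)) with (a + (0 + y) + 1) by ring.
    replace (a - (0 + y)) with (a - (1 + y) + 1) by ring.
    rewrite !P2; unfold minus, plus, opp; simpl; ring. }
  refine (eq_ind _ (fun d => is_derive _ y d) _ _ E0).
  apply (is_derive_minus (V := R_NormedModule)); apply is_derive_shift, Dv. }
assert (v0 : v 0 = 0) by (unfold v; rewrite Rplus_0_r, Rminus_0_r; ring).
assert (Mono : forall x y, 0 <= x -> x <= y -> y <= 1 / 2 -> q2 x + mu * x <= q2 y + mu * y).
{ intros x y Hx Hxy Hy.
  assert (H := derive_lower_bound q2 q1 x y (- mu) Hxy (fun w _ => D2 w)
    (fun w Hw => Hq w ltac:(lra))); lra. }
(* Both ends of [a - z, a + z] are folded into [0, 1/2], where [q2 x + mu * x] is nondecreasing: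
   [a - z] to its absolute value and [a + z], if beyond 1/2, to [1 - (a + z)]. The folding preserves
   [q2], and the order as well since [a] and [z] are at most 1/2. *)
assert (HT : forall z, 0 <= z <= 1 / 2 -> 0 <= q2 (a + z) - q2 (a - z) + 2 * mu * z).
{ intros z Hz.
  assert (L : q2 (a - z) + mu * (a - z) <= q2 (Rabs (a - z)) + mu * Rabs (a - z)).
  { apply Rplus_le_compat.
    - unfold Rabs; destruct Rcase_abs; rewrite ?Ev; lra.
    - apply Rmult_le_compat_l; [exact Hmu|apply Rle_abs]. }
  destruct (Rle_dec (a + z) (1 / 2)) as [H|H].
  - assert (K := Mono (Rabs (a - z)) (a + z) (Rabs_pos _)
      ltac:(apply Rabs_le; lra) ltac:(lra)); nra.
  - assert (K := Mono (Rabs (a - z)) (1 - (a + z)) (Rabs_pos _)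
      ltac:(apply Rabs_le; lra) ltac:(lra)).
    replace (1 - (a + z)) with (- (a + z) + 1) in K at 1 by ring.
    rewrite P2, Ev in K; nra. }
assert (HU : forall z, 0 <= z <= 1 / 2 -> 0 <= v z + mu * z ^ 2).
{ intros z Hz.
  assert (H := derive_lower_bound (fun z => v z + mu * z ^ 2)
    (fun z => (q2 (a + z) - q2 (a - z)) + mu * (2 * z)) 0 z 0 ltac:(lra)).
  cbv beta in H; rewrite v0 in H.
  enough (0 * (z - 0) <= v z + mu * z ^ 2 - (0 + mu * 0 ^ 2)) by lra.
  apply H.
  - intros x Hx; apply (is_derive_plus (V := R_NormedModule)); [apply Dv|].
    apply is_derive_scal; auto_derive; auto; ring.
  - intros x Hx; assert (K := HT x ltac:(lra)); lra. }
intros z Hz; fold (v z).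
(* Folding [z] into [0, 1/2] keeps [v] and does not increase [z], so the term [mu * z ^ 2] can only
   help. *)
assert (Hr : exists y, 0 <= y <= 1 / 2 /\ y <= z /\ v z = v y).
{ destruct (Rle_dec z (1 / 2)) as [Hs|Hs]; [exists z; lra|].
  destruct (periodic_reduce v z Pv) as [y [Hy E]].
  destruct (Rle_dec y (1 / 2)) as [Hy'|Hy'].
  - exists y; lra.
  - exists (1 - y); repeat split; try lra.
    replace (1 - y) with (- y + 1) by ring; rewrite Pv, Evv; exact E. }
destruct Hr as [y [Hy [Hyz ->]]].
assert (K := HU y Hy); assert (y ^ 2 <= z ^ 2) by (apply pow_incr; lra); nra.
Qed.

(** * Comparison arguments for the potential of a flow *)

Section Flow.
Context (alpha c m : R) (rho u F : R -> R -> R).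
Context (Halpha : 0 < alpha < 2) (Hc : 0 < c) (Hm : 0 < m).
Context (HF : flow_potential alpha c m rho u F).

Lemma potential_space_continuous (t x : R) : 0 <= t -> continuous (fun x => F x t) x.
Proof. intros Ht; exact (derive_continuous _ _ _ (potential_dx _ _ _ _ _ _ HF x t Ht)). Qed.

Lemma potential_pullback_continuous (a : R * R -> R) (p : R * R * R) :
  (forall q, continuous a q) ->
  continuous (fun p : R * R * R => F (a (fst p)) (Rmax 0 (snd p))) p.
Proof.
intros Ca.
apply (continuous_comp_2 (fun p : R * R * R => a (fst p)) (fun p : R * R * R => snd p)
  (fun x t => F x (Rmax 0 t))).
- apply (continuous_comp (fun p : R * R * R => fst p) a); [destruct p; apply continuous_fst|apply Ca].
- destruct p; apply continuous_snd.
- apply (potential_continuous _ _ _ _ _ _ HF).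
Qed.

(** The second difference of [F] at [x] is a primitive in [z] of [rho (x + z) t - rho (x - z) t], so
    [truncated_integral_limit_ge] applies to linear combinations. The caller supplies two further
    primitives [T] and [U] vanishing at 0; [w = 0] yields a sign, a positive [w] a quantitative
    gain. *)
Lemma velocity_combination (t x1 x2 x3 e1 e2 e3 w : R) (T U : R -> R) :
  0 <= t ->
  (forall z, is_derive T z
    (e1 * (F (x1 + z) t + F (x1 - z) t - 2 * F x1 t) +
     e2 * (F (x2 + z) t + F (x2 - z) t - 2 * F x2 t) +
     e3 * (F (x3 + z) t + F (x3 - z) t - 2 * F x3 t))) ->
  (forall z, is_derive U z (T z)) -> T 0 = 0 -> U 0 = 0 ->
  (forall z, 0 <= z -> 0 <= U z) ->
  0 <= w -> (forall z, 2 <= z <= 3 -> w <= U z) ->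
  e1 * u x1 t + e2 * u x2 t + e3 * u x3 t <= - (c * (kernel_constant alpha * w)).
Proof.
intros Ht DT DU T0 U0 PU Pw WU.
destruct HF as [_ Dr _ _ DF _ _ SD Vel].
set (s := fun x z => rho (x + z) t - rho (x - z) t).
assert (Cr : forall x, continuous (fun y => rho y t) x).
{ intros x; apply (ex_derive_continuous (K := R_AbsRing) (V := R_NormedModule)), Dr, Ht. }
assert (Cs : forall x z, continuous (s x) z).
{ intros x z; apply (continuous_minus (V := R_NormedModule)).
  - apply (continuous_comp (fun z => x + z) (fun y => rho y t)); [|apply Cr].
    apply (ex_derive_continuous (K := R_AbsRing) (V := R_NormedModule)); auto_derive; auto.
  - apply (continuous_comp (fun z => x - z) (fun y => rho y t)); [|apply Cr].
    apply (ex_derive_continuous (K := R_AbsRing) (V := R_NormedModule)); auto_derive; auto. }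
assert (Cse : forall e x z, continuous (fun z => e * s x z) z).
{ intros e x z; apply (continuous_scal_r (V := R_NormedModule)), Cs. }
destruct (SD t Ht) as [B HB].
set (s3 := fun z => e1 * s x1 z + e2 * s x2 z + e3 * s x3 z).
assert (L : is_lim_seq (truncated_integral alpha s3)
  (- (e1 * u x1 t + e2 * u x2 t + e3 * u x3 t) / c)).
{ assert (V := fun e x => is_lim_seq_scal_l _ (e / c) _ (Vel x t Ht)); simpl in V.
  assert (V3 := is_lim_seq_plus' _ _ _ _
    (is_lim_seq_plus' _ _ _ _ (V e1 x1) (V e2 x2)) (V e3 x3)).
  replace (- (e1 * u x1 t + e2 * u x2 t + e3 * u x3 t) / c) with
    (e1 / c * - u x1 t + e2 / c * - u x2 t + e3 / c * - u x3 t) by (field; lra).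
  eapply is_lim_seq_ext; [|exact V3]; intros n; cbv beta.
  unfold s3; rewrite truncated_integral_plus, truncated_integral_plus; auto.
  2:{ intros z; apply (continuous_plus (V := R_NormedModule)); apply Cse. }
  rewrite !truncated_integral_scal by (apply Cs).
  unfold s; field; lra. }
assert (G : kernel_constant alpha * w <=
  - (e1 * u x1 t + e2 * u x2 t + e3 * u x3 t) / c).
{ eapply (truncated_integral_limit_ge alpha s3
    (fun z => e1 * (F (x1 + z) t + F (x1 - z) t - 2 * F x1 t) +
     e2 * (F (x2 + z) t + F (x2 - z) t - 2 * F x2 t) +
     e3 * (F (x3 + z) t + F (x3 - z) t - 2 * F x3 t)) T U
    ((Rabs e1 + Rabs e2 + Rabs e3) * B)); auto.
  - intros z; apply (continuous_plus (V := R_NormedModule)); [|apply Cse].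
    apply (continuous_plus (V := R_NormedModule)); apply Cse.
  - intros z; apply is_derive_combination;
      apply (is_derive_second_difference (fun y => F y t) (fun y => rho y t));
      intros y; apply DF, Ht.
  - intros z Hz.
    assert (Q : forall k, (forall x, Rabs (F (x + z) t + F (x - z) t - 2 * F x t) <= k) ->
      Rabs (e1 * (F (x1 + z) t + F (x1 - z) t - 2 * F x1 t) +
       e2 * (F (x2 + z) t + F (x2 - z) t - 2 * F x2 t) +
       e3 * (F (x3 + z) t + F (x3 - z) t - 2 * F x3 t)) <=
      (Rabs e1 + Rabs e2 + Rabs e3) * k).
    { intros k Hk; rewrite !Rmult_plus_distr_r.
      eapply Rle_trans; [apply Rabs_triang|]; apply Rplus_le_compat;
        [eapply Rle_trans; [apply Rabs_triang|]; apply Rplus_le_compat|];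
        rewrite Rabs_mult; apply Rmult_le_compat_l; auto; apply Rabs_pos. }
    rewrite Rmult_assoc; split; apply Q; intros x; apply HB, Hz. }
apply (Rmult_le_compat_l c) in G; [|lra].
replace (c * (- (e1 * u x1 t + e2 * u x2 t + e3 * u x3 t) / c)) with
  (- (e1 * u x1 t + e2 * u x2 t + e3 * u x3 t)) in G by (field; lra).
lra.
Qed.

(** Increments of [F] are compared rather than values of [rho], because the time derivative of [F]
    involves no derivative of [u]. The density is recovered as the derivative of the increment at
    [h = 0]. *)
Lemma density_nonnegative :
  (forall x, 0 <= rho x 0) -> forall x t, 0 <= t -> 0 <= rho x t.
Proof.
intros H0.
assert (DF := potential_dx _ _ _ _ _ _ HF); assert (PF := potential_periodic _ _ _ _ _ _ HF).
assert (Hmain : forall x h t, 0 <= x <= 1 -> 0 <= h <= 1 -> 0 <= t -> F x t - F (x + h) t <= 0).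
{ apply (parabolic_maximum_principle (fun x h t => F x t - F (x + h) t)).
  - intros p; apply (continuous_minus (V := R_NormedModule)).
    + apply (potential_pullback_continuous fst); intros []; apply continuous_fst.
    + apply (potential_pullback_continuous (fun q => fst q + snd q)); intros [].
      apply (continuous_plus (V := R_NormedModule)); [apply continuous_fst|apply continuous_snd].
  - intros x h _ Hh.
    assert (K := derive_lower_bound (fun y => F y 0) (fun y => rho y 0) x (x + h) 0 ltac:(lra)
      (fun y _ => DF y 0 (Rle_refl 0)) (fun y _ => H0 y)); cbv beta in K; lra.
  - intros x h t Hx Hh Ht Hpos Hmax.
    assert (Ht' : 0 <= t) by lra.
    (* The function is 0 at [h = 0] and [- m] at [h = 1], so a positive maximum lies strictly
       between. *)
    assert (Hh1 : 0 < h < 1).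
    { split; apply Rnot_le_lt; intros Hle.
      - replace h with 0 in Hpos by lra; rewrite Rplus_0_r in Hpos; lra.
      - replace h with 1 in Hpos by lra; rewrite PF in Hpos by lra; lra. }
    assert (E1 : rho (x + h) t = 0).
    { enough (- rho (x + h) t = 0) by lra.
      apply (is_derive_interior_max (fun h => F x t - F (x + h) t) 0 1 h); auto.
      rewrite <- (Rminus_0_l (rho (x + h) t)).
      apply (is_derive_minus (V := R_NormedModule));
        [apply (is_derive_const (V := R_NormedModule))|].
      apply (is_derive_shift (fun y => F y t)), DF, Ht'. }
    assert (E2 : rho x t - rho (x + h) t = 0).
    { apply (is_derive_interior_max (fun y => F y t - F (y + h) t) (x - 1) (x + 1) x); [|lra|].
      - apply (is_derive_minus (V := R_NormedModule)); [apply DF, Ht'|].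
        apply (is_derive_ext (fun y => F (h + y) t)); [intros y; f_equal; ring|].
        apply (is_derive_shift (fun y => F y t)); rewrite Rplus_comm; apply DF, Ht'.
      (* Periodicity extends the maximum from [0, 1] to the whole line, which makes [x] interior. *)
      - intros y _; destruct (periodic_reduce (fun y => F y t - F (y + h) t) y) as [y' [Hy' E]].
        + intros w; replace (w + 1 + h) with (w + h + 1) by ring; rewrite !PF by lra; ring.
        + rewrite E; auto. }
    eexists; split.
    + apply (is_derive_minus (V := R_NormedModule)); apply (potential_dt _ _ _ _ _ _ HF), Ht.
    + unfold minus, plus, opp; simpl; rewrite E1; replace (rho x t) with 0 by lra; lra. }
intros x t Ht.
destruct (periodic_reduce (fun y => rho y t) x) as [y [Hy ->]].
{ intros w; apply (density_periodic _ _ _ _ _ _ HF), Ht. }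
enough (- rho y t <= 0) by lra.
apply (is_derive_right_max (fun h => F y t - F (y + h) t) 0).
- rewrite <- (Rminus_0_l (rho y t)).
  apply (is_derive_minus (V := R_NormedModule)); [apply (is_derive_const (V := R_NormedModule))|].
  apply (is_derive_shift (fun y => F y t)); rewrite Rplus_0_r; apply DF, Ht.
- exists 1; split; [lra|]; intros h Hh; rewrite Rplus_0_r, Rminus_diag.
  apply Hmain; lra.
Qed.

(** If the combined second difference is itself nonnegative, so are its primitives from 0 on the
    half-line; this is the case [w = 0], with weight 0 on the third point. *)
Lemma velocity_combination_nonpositive (t x1 x2 e1 e2 : R) (S : R -> R) :
  0 <= t ->
  (forall z, S z = e1 * (F (x1 + z) t + F (x1 - z) t - 2 * F x1 t) +
     e2 * (F (x2 + z) t + F (x2 - z) t - 2 * F x2 t)) ->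
  (forall z, 0 <= S z) ->
  e1 * u x1 t + e2 * u x2 t <= 0.
Proof.
intros Ht ES PS.
assert (CF := fun x => potential_space_continuous t x Ht).
assert (CS : forall z, continuous S z).
{ intros z.
  apply (continuous_ext (fun z => e1 * (F (x1 + z) t + F (x1 - z) t - 2 * F x1 t) +
     e2 * (F (x2 + z) t + F (x2 - z) t - 2 * F x2 t))); [intros y; symmetry; apply ES|].
  assert (Cx : forall x, continuous (fun z => F (x + z) t + F (x - z) t - 2 * F x t) z).
  { intros x; eapply derive_continuous.
    apply (is_derive_second_difference (fun y => F y t) (fun y => rho y t)).
    intros y; apply (potential_dx _ _ _ _ _ _ HF), Ht. }
  apply (continuous_plus (V := R_NormedModule));
    apply (continuous_scal_r (V := R_NormedModule)), Cx. }
assert (DT := fun x => is_derive_integral S x CS).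
set (T := fun z => RInt S 0 z) in *.
assert (CT : forall z, continuous T z) by (intros z; exact (derive_continuous _ _ _ (DT z))).
assert (DU := fun x => is_derive_integral T x CT).
set (U := fun z => RInt T 0 z) in *.
assert (T0 : T 0 = 0) by apply (RInt_point (V := R_CompleteNormedModule)).
assert (U0 : U 0 = 0) by apply (RInt_point (V := R_CompleteNormedModule)).
assert (PT : forall z, 0 <= z -> 0 <= T z).
{ intros z Hz; assert (K := derive_lower_bound T S 0 z 0 Hz (fun y _ => DT y) (fun y _ => PS y)); lra. }
assert (PU : forall z, 0 <= z -> 0 <= U z).
{ intros z Hz; assert (K := derive_lower_bound U T 0 z 0 Hz (fun y _ => DU y)
    (fun y Hy => PT y (proj1 Hy))); lra. }
assert (K := velocity_combination t x1 x2 0 e1 e2 0 0 T U Ht).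
enough (e1 * u x1 t + e2 * u x2 t + 0 * u 0 t <= - (c * (kernel_constant alpha * 0))) by lra.
apply K; auto; [|lra|intros z Hz; apply PU; lra].
intros z; match goal with |- is_derive _ _ ?d => replace d with (S z); [apply DT|rewrite ES; ring] end.
Qed.

(** The second differences of [F] at [x] and [- x] add up to that of [E] at [x], which is signed at
    a global extremum of [E]; there the derivative of [E] vanishes, so [rho] agrees at [x] and
    [- x]. Comparing [E] at two points cancels the flux at 0. Hence [E] stays constant in space, and
    [E] vanishes at 0. *)
Lemma potential_odd :
  (forall x, rho (- x) 0 = rho x 0) -> (forall x t, 0 <= t -> 0 <= rho x t) ->
  forall x t, 0 <= t -> F (- x) t = - F x t.
Proof.
intros Ev0 Pos.
assert (DF := potential_dx _ _ _ _ _ _ HF); assert (PF := potential_periodic _ _ _ _ _ _ HF).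
assert (F0 := potential_0 _ _ _ _ _ _ HF).
set (E := fun x t => F x t + F (- x) t).
assert (DE : forall x t, 0 <= t -> is_derive (fun x => E x t) x (rho x t - rho (- x) t)).
{ intros x t Ht; apply (is_derive_plus (V := R_NormedModule)); [apply DF, Ht|].
  apply (is_derive_opp_arg (fun y => F y t)), DF, Ht. }
assert (PE : forall x t, 0 <= t -> E (x + 1) t = E x t).
{ intros x t Ht; unfold E; replace (- x) with (- (x + 1) + 1) by ring.
  rewrite !PF by exact Ht; ring. }
assert (Et : forall x t, 0 < t -> is_derive (fun s => E x s) t
  ((rho 0 t * u 0 t - rho x t * u x t) + (rho 0 t * u 0 t - rho (- x) t * u (- x) t))).
{ intros x t Ht; apply (is_derive_plus (V := R_NormedModule));
    apply (potential_dt _ _ _ _ _ _ HF), Ht. }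
assert (Hmain : forall x y t, 0 <= x <= 1 -> 0 <= y <= 1 -> 0 <= t -> E x t - E y t <= 0).
{ apply (parabolic_maximum_principle (fun x y t => E x t - E y t)).
  - assert (Copp : forall a : R * R -> R, (forall q, continuous a q) ->
      forall q, continuous (fun q => - a q) q)
      by (intros a Ca q; apply (continuous_opp (V := R_NormedModule)), Ca).
    assert (C1 : forall q : R * R, continuous fst q) by (intros []; apply continuous_fst).
    assert (C2 : forall q : R * R, continuous snd q) by (intros []; apply continuous_snd).
    intros p; apply (continuous_minus (V := R_NormedModule));
      apply (continuous_plus (V := R_NormedModule)).
    + apply (potential_pullback_continuous fst), C1.
    + apply (potential_pullback_continuous (fun q => - fst q)), Copp, C1.
    + apply (potential_pullback_continuous snd), C2.
    + apply (potential_pullback_continuous (fun q => - snd q)), Copp, C2.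
  - intros x y _ _.
    enough (E x 0 = E y 0) by lra.
    apply (derive_zero_constant (fun x => E x 0)); intros w.
    assert (E0 : rho w 0 - rho (- w) 0 = 0) by (rewrite Ev0; ring).
    refine (eq_ind _ (fun d => is_derive _ w d) _ _ E0); apply DE; lra.
  - intros x y t Hx Hy Ht Hpos Hmax.
    assert (Ht' : 0 <= t) by lra.
    assert (Mx : forall z, E z t <= E x t).
    { intros z; destruct (periodic_reduce (fun z => E z t) z (fun z => PE z t Ht')) as [w [Hw ->]].
      specialize (Hmax w y Hw Hy); lra. }
    assert (My : forall z, E y t <= E z t).
    { intros z; destruct (periodic_reduce (fun z => E z t) z (fun z => PE z t Ht')) as [w [Hw ->]].
      specialize (Hmax x w Hx Hw); lra. }
    assert (Ex : rho x t - rho (- x) t = 0).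
    { apply (is_derive_interior_max (fun x => E x t) (x - 1) (x + 1) x); [apply DE, Ht'|lra|auto]. }
    assert (Ey : - (rho y t - rho (- y) t) = 0).
    { apply (is_derive_interior_max (fun x => - E x t) (y - 1) (y + 1) y); [|lra|].
      - apply (is_derive_opp (V := R_NormedModule)), DE, Ht'.
      - intros z _; specialize (My z); lra. }
    assert (Ux : -1 * u x t + -1 * u (- x) t <= 0).
    { apply (velocity_combination_nonpositive t x (- x) (-1) (-1)
        (fun z => 2 * E x t - E (x + z) t - E (x - z) t)); [exact Ht'| |].
      - intros z; unfold E; replace (- (x + z)) with (- x - z) by ring;
          replace (- (x - z)) with (- x + z) by ring; ring.
      - intros z; assert (H1 := Mx (x + z)); assert (H2 := Mx (x - z)); lra. }
    assert (Uy : 1 * u y t + 1 * u (- y) t <= 0).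
    { apply (velocity_combination_nonpositive t y (- y) 1 1
        (fun z => E (y + z) t + E (y - z) t - 2 * E y t)); [exact Ht'| |].
      - intros z; unfold E; replace (- (y + z)) with (- y - z) by ring;
          replace (- (y - z)) with (- y + z) by ring; ring.
      - intros z; assert (H1 := My (y + z)); assert (H2 := My (y - z)); lra. }
    eexists; split.
    + apply (is_derive_minus (V := R_NormedModule)); apply Et, Ht.
    + unfold minus, plus, opp; simpl.
      replace (rho (- x) t) with (rho x t) by lra; replace (rho (- y) t) with (rho y t) by lra.
      assert (Px := Pos x t Ht'); assert (Py := Pos y t Ht'); nra. }
intros x t Ht.
enough (Hx : E x t = 0) by (unfold E in Hx; lra).
destruct (periodic_reduce (fun z => E z t) x (fun z => PE z t Ht)) as [w [Hw ->]].
assert (E0 : E 0 t = 0) by (unfold E; rewrite Ropp_0, F0; ring).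
assert (H1 := Hmain w 0 t Hw ltac:(lra) Ht); assert (H2 := Hmain 0 w t ltac:(lra) Hw Ht); lra.
Qed.

(** Since [Z] is odd in [a], its minimum over [0, 1/2] need not be global, and the combined second
    difference [Z (a + z) h t + Z (a - z) h t - 2 * Z a h t] may change sign in [z]. Its second
    primitive does not, by [odd_periodic_second_primitive], and that suffices for
    [velocity_combination]. *)
Lemma potential_midpoint_convex :
  (forall x, rho (- x) 0 = rho x 0) -> (forall x t, 0 <= t -> 0 <= rho x t) ->
  (forall x y, 0 <= x -> x <= y -> y <= 1 / 2 -> rho x 0 <= rho y 0) ->
  forall a h t, 0 <= a <= 1 / 2 -> 0 <= t -> 0 <= F (a + h) t + F (a - h) t - 2 * F a t.
Proof.
intros Ev0 Pos Mono0.
assert (Odd := potential_odd Ev0 Pos).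
assert (DF := potential_dx _ _ _ _ _ _ HF); assert (PF := potential_periodic _ _ _ _ _ _ HF).
assert (Pr0 := fun x => density_periodic _ _ _ _ _ _ HF x 0 (Rle_refl 0)).
set (Z := fun a h t => F (a + h) t + F (a - h) t - 2 * F a t).
assert (Dh : forall a h t, 0 <= t ->
  is_derive (fun h => Z a h t) h (rho (a + h) t - rho (a - h) t)).
{ intros a h t Ht; apply (is_derive_second_difference (fun y => F y t) (fun y => rho y t)).
  intros y; apply DF, Ht. }
assert (Da : forall a h t, 0 <= t ->
  is_derive (fun a => Z a h t) a (rho (a + h) t + rho (a - h) t - 2 * rho a t)).
{ intros a h t Ht; apply (is_derive_second_difference_center (fun y => F y t) (fun y => rho y t)).
  intros y; apply DF, Ht. }
assert (PZh : forall a h t, 0 <= t -> Z a (h + 1) t = Z a h t).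
{ intros a h t Ht; unfold Z; replace (a + (h + 1)) with (a + h + 1) by ring.
  replace (a - h) with (a - (h + 1) + 1) by ring; rewrite !PF by exact Ht; ring. }
assert (PZa : forall a h t, 0 <= t -> Z (a + 1) h t = Z a h t).
{ intros a h t Ht; unfold Z; replace (a + 1 + h) with (a + h + 1) by ring.
  replace (a + 1 - h) with (a - h + 1) by ring; rewrite !PF by exact Ht; ring. }
assert (EZh : forall a h t, Z a (- h) t = Z a h t).
{ intros a h t; unfold Z; replace (a + - h) with (a - h) by ring.
  replace (a - - h) with (a + h) by ring; ring. }
assert (OZa : forall a h t, 0 <= t -> Z (- a) h t = - Z a h t).
{ intros a h t Ht; unfold Z; replace (- a + h) with (- (a - h)) by ring.
  replace (- a - h) with (- (a + h)) by ring; rewrite !Odd by exact Ht; ring. }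
assert (Z00 : forall a t, Z a 0 t = 0).
{ intros a t; unfold Z; rewrite Rplus_0_r, Rminus_0_r; ring. }
assert (Init : forall a h, 0 <= a <= 1 / 2 -> 0 <= h <= 1 / 2 -> 0 <= Z a h 0).
{ intros a h Ha Hh.
  assert (K := derive_lower_bound (fun h => Z a h 0) (fun h => rho (a + h) 0 - rho (a - h) 0)
    0 h 0 ltac:(lra) (fun y _ => Dh a y 0 (Rle_refl 0))).
  cbv beta in K; rewrite Z00 in K.
  enough (0 * (h - 0) <= Z a h 0 - 0) by lra.
  apply K; intros s Hs.
  (* At time 0 both points are folded into [0, 1/2] by the symmetries about 0 and 1/2; monotonicity
     of the datum then compares them. *)
  replace (rho (a - s) 0) with (rho (Rabs (a - s)) 0)
    by (unfold Rabs; destruct Rcase_abs; rewrite ?Ev0; reflexivity).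
  assert (Pa := Rabs_pos (a - s)).
  destruct (Rle_dec (a + s) (1 / 2)) as [H|H].
  - assert (Q := Mono0 (Rabs (a - s)) (a + s) Pa ltac:(apply Rabs_le; lra) H); lra.
  - assert (Q := Mono0 (Rabs (a - s)) (- (a + s) + 1) Pa ltac:(apply Rabs_le; lra) ltac:(lra)).
    rewrite Pr0, Ev0 in Q; lra. }
assert (Hmain : forall a h t, 0 <= a <= 1 / 2 -> 0 <= h <= 1 -> 0 <= t -> - Z a h t <= 0).
{ apply (parabolic_maximum_principle (fun a h t => - Z a h t)).
  - assert (C1 : forall q : R * R, continuous fst q) by (intros []; apply continuous_fst).
    assert (C2 : forall q : R * R, continuous snd q) by (intros []; apply continuous_snd).
    intros p; apply (continuous_opp (V := R_NormedModule)),
      (continuous_minus (V := R_NormedModule));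
      [apply (continuous_plus (V := R_NormedModule))|apply (continuous_scal_r (V := R_NormedModule))].
    + apply (potential_pullback_continuous (fun q => fst q + snd q)); intros q.
      apply (continuous_plus (V := R_NormedModule)); [apply C1|apply C2].
    + apply (potential_pullback_continuous (fun q => fst q - snd q)); intros q.
      apply (continuous_minus (V := R_NormedModule)); [apply C1|apply C2].
    + apply (potential_pullback_continuous fst), C1.
  - intros a h Ha Hh.
    destruct (Rle_dec h (1 / 2)) as [H|H].
    + assert (Q := Init a h Ha ltac:(lra)); lra.
    + assert (Q := Init a (- h + 1) Ha ltac:(lra)).
      rewrite PZh, EZh in Q by lra; lra.
  - intros a h t Ha Hh Ht Hpos Hmax; cbv beta in Hpos, Hmax.
    assert (Ht' : 0 <= t) by lra.
    (* An odd 1-periodic function vanishes at 0 and at 1/2, so the positive maximum of [- Z] is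
       interior and both first-order conditions hold. Together they give
       [rho (a + h) t = rho (a - h) t = rho a t]. *)
    assert (Ha1 : 0 < a < 1 / 2).
    { split; apply Rnot_le_lt; intros Hle.
      - replace a with 0 in Hpos by lra.
        assert (Q := OZa 0 h t Ht'); rewrite Ropp_0 in Q; lra.
      - replace a with (1 / 2) in Hpos by lra.
        assert (Q := OZa (1 / 2) h t Ht'); rewrite <- PZa in Q by exact Ht'.
        replace (- (1 / 2) + 1) with (1 / 2) in Q by lra; lra. }
    assert (Hh1 : 0 < h < 1).
    { split; apply Rnot_le_lt; intros Hle.
      - replace h with 0 in Hpos by lra; rewrite Z00 in Hpos; lra.
      - replace h with (0 + 1) in Hpos by lra; rewrite PZh, Z00 in Hpos by exact Ht'; lra. }
    assert (E1 : - (rho (a + h) t - rho (a - h) t) = 0).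
    { apply (is_derive_interior_max (fun h => - Z a h t) 0 1 h); [|exact Hh1|auto].
      apply (is_derive_opp (V := R_NormedModule)), Dh, Ht'. }
    assert (E2 : - (rho (a + h) t + rho (a - h) t - 2 * rho a t) = 0).
    { apply (is_derive_interior_max (fun a => - Z a h t) 0 (1 / 2) a); [|exact Ha1|auto].
      apply (is_derive_opp (V := R_NormedModule)), Da, Ht'. }
    assert (DP := fun x => is_derive_integral (fun y => F y t) x
      (fun y => potential_space_continuous t y Ht')).
    set (P := fun x => RInt (fun y => F y t) 0 x) in DP.
    assert (DPP := fun x => is_derive_integral P x (fun y => derive_continuous _ _ _ (DP y))).
    set (PP := fun x => RInt P 0 x) in DPP.
    (* Taking second differences commutes with integrating: [q2] and [q3] are the first and second
       primitives of [Z] in its centre. *)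
    set (q2 := fun b => P (b + h) + P (b - h) - 2 * P b).
    set (q3 := fun b => PP (b + h) + PP (b - h) - 2 * PP b).
    assert (Dq2 : forall b, is_derive q2 b (Z b h t)).
    { intros b; apply (is_derive_second_difference_center P (fun y => F y t)), DP. }
    assert (Dq3 : forall b, is_derive q3 b (q2 b)).
    { intros b; apply (is_derive_second_difference_center PP P), DPP. }
    set (mu := - Z a h t) in *.
    assert (Zmin : forall b, 0 <= b <= 1 / 2 -> - mu <= Z b h t).
    { intros b Hb; specialize (Hmax b h Hb Hh); lra. }
    assert (PU := odd_periodic_second_primitive (fun b => Z b h t) q2 q3 a mu Dq2 Dq3
      (fun b => OZa b h t Ht') (fun b => PZa b h t Ht') ltac:(lra) Ha Zmin).
    assert (U : 1 * u (a + h) t + 1 * u (a - h) t + -2 * u a t <=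
      - (c * (kernel_constant alpha * 0))).
    { apply (velocity_combination t (a + h) (a - h) a 1 1 (-2) 0
        (fun z => q2 (a + z) - q2 (a - z) + mu * (2 * z))
        (fun z => q3 (a + z) + q3 (a - z) - 2 * q3 a + mu * z ^ 2)); try lra.
      - intros z.
        replace (1 * (F (a + h + z) t + F (a + h - z) t - 2 * F (a + h) t) +
          1 * (F (a - h + z) t + F (a - h - z) t - 2 * F (a - h) t) +
          -2 * (F (a + z) t + F (a - z) t - 2 * F a t)) with
          (plus (Z (a + z) h t + Z (a - z) h t) (mu * 2)).
        + apply (is_derive_plus (V := R_NormedModule));
            [apply is_derive_symmetric_difference; apply Dq2|].
          apply is_derive_scal; auto_derive; auto; ring.
        + unfold plus, mu, Z; simpl.
          replace (a + h + z) with (a + z + h) by ring; replace (a - h + z) with (a + z - h) by ring.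
          replace (a + h - z) with (a - z + h) by ring; replace (a - h - z) with (a - z - h) by ring.
          ring.
      - intros z; apply (is_derive_plus (V := R_NormedModule)).
        + apply (is_derive_second_difference q3 q2), Dq3.
        + apply is_derive_scal; auto_derive; auto; ring.
      - rewrite Rplus_0_r, Rminus_0_r; ring.
      - rewrite Rplus_0_r, Rminus_0_r; ring.
      - exact PU.
      - intros z Hz; apply PU; lra. }
    (* The three densities agree and factor out; the fluxes at 0 cancel, the weights -1, -1 and 2
       having sum zero. *)
    exists (rho a t * (u (a + h) t + u (a - h) t - 2 * u a t)); split.
    + assert (Dt := fun x => potential_dt _ _ _ _ _ _ HF x t Ht).
      assert (D := is_derive_combination _ _ _ (-1) (-1) 2 t _ _ _
        (Dt (a + h)) (Dt (a - h)) (Dt a)).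
      replace (rho a t * (u (a + h) t + u (a - h) t - 2 * u a t)) with
        (-1 * (rho 0 t * u 0 t - rho (a + h) t * u (a + h) t) +
         -1 * (rho 0 t * u 0 t - rho (a - h) t * u (a - h) t) +
         2 * (rho 0 t * u 0 t - rho a t * u a t)).
      * eapply is_derive_ext; [|exact D]; intros s; unfold Z; simpl; ring.
      * replace (rho (a + h) t) with (rho a t) by lra.
        replace (rho (a - h) t) with (rho a t) by lra; ring.
    + assert (Pa := Pos a t Ht'); nra. }
intros a h t Ha Ht; fold (Z a h t).
destruct (periodic_reduce (fun h => Z a h t) h (fun h => PZh a h t Ht)) as [w [Hw ->]].
assert (Q := Hmain a w t Ha Hw Ht); lra.
Qed.

(** If [rho] had negative slope at some [a], then [rho (a + s) t - rho (a - s) t], the derivative in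
    [s] of the second difference, would be negative for small positive [s]; starting from 0, the
    second difference would become negative. *)
Lemma density_nondecreasing (t : R) :
  0 <= t ->
  (forall a h, 0 <= a <= 1 / 2 -> 0 <= F (a + h) t + F (a - h) t - 2 * F a t) ->
  forall x y, 0 <= x -> x <= y -> y <= 1 / 2 -> rho x t <= rho y t.
Proof.
intros Ht HZ x y Hx Hxy Hy.
assert (DF := fun y => potential_dx _ _ _ _ _ _ HF y t Ht).
assert (Dr := fun y => Derive_correct _ _ (density_derivable _ _ _ _ _ _ HF y t Ht)).
enough (K : 0 * (y - x) <= rho y t - rho x t) by lra.
apply (derive_lower_bound (fun y => rho y t) (Derive (fun y => rho y t)) x y 0 Hxy);
  [intros w _; apply Dr|].
intros a Ha; apply Rnot_lt_le; intros Hneg.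
assert (Ds : is_derive (fun s => rho (a + s) t - rho (a - s) t) 0
  (Derive (fun y => rho y t) a + Derive (fun y => rho y t) a)).
{ apply (is_derive_symmetric_difference (fun y => rho y t));
    rewrite ?Rplus_0_r, ?Rminus_0_r; apply Dr. }
set (d := Derive (fun y => rho y t) a) in *.
apply is_derive_Reals in Ds.
(* The limit slope is [2 * d]; the tolerance [- d] keeps the difference quotient below [d], hence
   negative. *)
destruct (Ds (- d)) as [[e He] Hlim]; [lra|]; simpl in Hlim.
assert (Hs : forall s, 0 < s < e -> rho (a + s) t - rho (a - s) t < 0).
{ intros s Hs; specialize (Hlim s ltac:(lra)); rewrite (Rabs_pos_eq s) in Hlim by lra.
  specialize (Hlim ltac:(lra)).
  rewrite Rplus_0_l, Rplus_0_r, Rminus_0_r, Rminus_diag, Rminus_0_r in Hlim.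
  apply Rabs_def2 in Hlim; destruct Hlim as [Hl _].
  assert (Hq : (rho (a + s) t - rho (a - s) t) / s < 0) by lra.
  apply (Rmult_lt_compat_r s) in Hq; [|lra].
  replace ((rho (a + s) t - rho (a - s) t) / s * s) with (rho (a + s) t - rho (a - s) t) in Hq
    by (field; lra); lra. }
set (Zf := fun h => F (a + h) t + F (a - h) t - 2 * F a t).
assert (DZ : forall h, is_derive Zf h (rho (a + h) t - rho (a - h) t)).
{ intros h; apply (is_derive_second_difference (fun y => F y t) (fun y => rho y t)), DF. }
destruct (MVT_cor2 Zf (fun h => rho (a + h) t - rho (a - h) t) 0 (e / 2)) as [s [E Hse]];
  [lra|intros s _; apply is_derive_Reals, DZ|].
assert (Z0 : Zf 0 = 0) by (unfold Zf; rewrite Rplus_0_r, Rminus_0_r; ring).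
assert (Q := HZ a (e / 2) ltac:(lra)); fold (Zf (e / 2)) in Q.
specialize (Hs s ltac:(lra)); rewrite Z0 in E; nra.
Qed.

(* The integral over [0, 1] of the second difference at x is 2 m x - 2 F(x),
   and F(x) <= x rho(x) <= m x / 2 because rho is nondecreasing on [0, x]. *)
Lemma velocity_upper_bound (x t : R) :
  0 <= t -> 0 <= x <= 1 / 2 ->
  (forall y, F (- y) t = - F y t) ->
  (forall a h, 0 <= a <= 1 / 2 -> 0 <= F (a + h) t + F (a - h) t - 2 * F a t) ->
  rho x t <= m / 2 ->
  u x t <= - (c * (kernel_constant alpha * (m * x))).
Proof.
intros Ht Hx Odd HZ Hr.
assert (DF := fun y => potential_dx _ _ _ _ _ _ HF y t Ht).
assert (PF := fun y => potential_periodic _ _ _ _ _ _ HF y t Ht).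
assert (F0 := potential_0 _ _ _ _ _ _ HF t).
assert (Fx : F x t <= x * (m / 2)).
{ assert (K := derive_lower_bound (fun y => - F y t) (fun y => - rho y t) 0 x (- (m / 2))
    (proj1 Hx)); cbv beta in K; rewrite F0 in K.
  enough (- (m / 2) * (x - 0) <= - F x t - - 0) by lra.
  apply K.
  - intros y _; apply (is_derive_opp (V := R_NormedModule)), DF.
  - intros y Hy.
    assert (Q := density_nondecreasing t Ht HZ y x ltac:(lra) ltac:(lra) ltac:(lra)); lra. }
assert (DP := fun x => is_derive_integral (fun y => F y t) x
  (fun y => potential_space_continuous t y Ht)).
set (P := fun x => RInt (fun y => F y t) 0 x) in DP.
assert (DPP := fun x => is_derive_integral P x (fun y => derive_continuous _ _ _ (DP y))).
set (PP := fun x => RInt P 0 x) in DPP.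
(* [P] is even because [F] is odd; this fixes the constant in the next identity, whose derivative is
   [2 * m] since [F] gains [m] per period. *)
assert (EP : P (-1) = P 1).
{ enough (E : P (0 + 1) - P (0 - 1) = P (0 + 0) - P (0 - 0)).
  { replace (0 + 1) with 1 in E by ring; replace (0 - 1) with (-1) in E by ring.
    rewrite Rplus_0_r, Rminus_0_r in E; lra. }
  apply (derive_zero_constant (fun y => P (0 + y) - P (0 - y))); intros y.
  assert (E0 : F (0 + y) t + F (0 - y) t = 0)
    by (rewrite Rplus_0_l, Rminus_0_l, Odd; ring).
  refine (eq_ind _ (fun d => is_derive _ y d) _ _ E0).
  apply is_derive_symmetric_difference; apply DP. }
assert (E1 : P (1 + x) - P (-1 + x) = 2 * m * x).
{ enough (E : P (1 + x) - P (-1 + x) - 2 * m * x = P (1 + 0) - P (-1 + 0) - 2 * m * 0)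
    by (rewrite !Rplus_0_r in E; lra).
  apply (derive_zero_constant (fun y => P (1 + y) - P (-1 + y) - 2 * m * y)); intros y.
  assert (E0 : minus (minus (F (1 + y) t) (F (-1 + y) t)) (2 * m) = 0).
  { replace (1 + y) with (-1 + y + 1 + 1) by ring; rewrite !PF.
    unfold minus, plus, opp; simpl; ring. }
  refine (eq_ind _ (fun d => is_derive _ y d) _ _ E0).
  apply (is_derive_minus (V := R_NormedModule)); [|auto_derive; auto; ring].
  apply (is_derive_minus (V := R_NormedModule)); apply is_derive_shift, DP. }
set (T := fun z => P (x + z) - P (x - z) - 2 * F x t * z).
set (U := fun z => PP (x + z) + PP (x - z) - 2 * PP x - F x t * z ^ 2).
assert (DT : forall z, is_derive T z (F (x + z) t + F (x - z) t - 2 * F x t)).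
{ intros z; apply (is_derive_minus (V := R_NormedModule)); [|auto_derive; auto; ring].
  apply is_derive_symmetric_difference; apply DP. }
assert (DU : forall z, is_derive U z (T z)).
{ intros z; apply (is_derive_minus (V := R_NormedModule)); [|auto_derive; auto; ring].
  apply (is_derive_second_difference PP P), DPP. }
assert (T0 : T 0 = 0) by (unfold T; rewrite Rplus_0_r, Rminus_0_r; ring).
assert (U0 : U 0 = 0) by (unfold U; rewrite Rplus_0_r, Rminus_0_r; ring).
assert (MT : forall y z, y <= z -> T y <= T z).
{ intros y z Hyz; assert (K := derive_lower_bound T _ y z 0 Hyz (fun w _ => DT w)
    (fun w _ => HZ x w Hx)); lra. }
assert (T1 : m * x <= T 1).
{ unfold T; replace (x + 1) with (1 + x) by ring; replace (x - 1) with (-1 + x) by ring; lra. }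
assert (Hmx : 0 <= m * x) by (apply Rmult_le_pos; lra).
assert (PT : forall z, 0 <= z -> 0 <= T z) by (intros z Hz; specialize (MT 0 z Hz); lra).
assert (PU : forall z, 0 <= z -> 0 <= U z).
{ intros z Hz; assert (K := derive_lower_bound U T 0 z 0 Hz (fun w _ => DU w)
    (fun w Hw => PT w (proj1 Hw))); lra. }
assert (G : 1 * u x t + 0 * u 0 t + 0 * u 0 t <=
  - (c * (kernel_constant alpha * (m * x)))); [|lra].
apply (velocity_combination t x 0 0 1 0 0 (m * x) T U); auto.
- intros z; match goal with |- is_derive _ _ ?d =>
    replace d with (F (x + z) t + F (x - z) t - 2 * F x t) by ring end; apply DT.
- intros z Hz.
  (* [T] is nondecreasing, hence at least [m * x] from 1 on. So [U] gains at least [m * x] between 1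
     and 2, which is why its lower bound is asked on [2, 3]. *)
  assert (K := derive_lower_bound U T 1 z (m * x) ltac:(lra) (fun w _ => DU w)).
  assert (K' : m * x * (z - 1) <= U z - U 1)
    by (apply K; intros w Hw; specialize (MT 1 w (proj1 Hw)); lra).
  assert (Q := PU 1 ltac:(lra)); nra.
Qed.

End Flow.

(** * The velocity bound for classical solutions *)

Theorem theorem3p1 :
  forall (alpha c m rho_max : R),
    0 < alpha < 2 ->
    c_alpha_spec alpha c ->
    0 < m -> 0 < rho_max ->
    exists A : R, 0 < A /\
      forall (rho0 : R -> R) (rho u : R -> R -> R),
        smooth rho0 ->
        (forall x, rho0 (x + 1) = rho0 x) ->
        (forall x, rho0 x = rho0 (- x)) ->                         (* H1 *)
        (forall x, 0 <= rho0 x <= rho_max) ->                      (* H2 *)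
        rho0 0 = 0 ->                                              (* H3 *)
        (forall x, 0 <= x <= 1 / 2 -> forall d,
            derivable_pt_lim rho0 x d -> 0 <= d) ->                (* H3 *)
        integral_eq rho0 (- (1 / 2)) (1 / 2) m ->
        classical_solution rho0 rho u ->
        velocity_formula alpha c rho u ->
        forall x t, 0 <= x <= delta_const alpha -> 0 <= t ->
          rho x t <= m / 2 ->
          u x t <= - A * x.
Proof.
intros alpha c m rho_max Ha Hca Hm _.
assert (Hc := c_alpha_positive _ _ Hca).
assert (Hk : 0 < kernel_constant alpha).
{ unfold kernel_constant; assert (P := Rpower_pos 3 (- alpha - 3)).
  repeat apply Rmult_lt_0_compat; lra. }
(* The constant is the one of [velocity_upper_bound] with the factor [x] taken out. *)
exists (c * kernel_constant alpha * m); split.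
{ apply Rmult_lt_0_compat; [apply Rmult_lt_0_compat|]; assumption. }
intros rho0 rho u [D [HD0 HD]] _ Even Bounds _ Mono Hmass Hsol Hvel x t Hx Ht Hr.
assert (HF := classical_flow_potential alpha c m rho0 rho u Hmass Hsol Hvel).
set (F := fun x t => RInt (fun y => rho y t) 0 x) in HF.
assert (E0 : forall x, rho x 0 = rho0 x) by apply Hsol.
assert (Pos : forall x t, 0 <= t -> 0 <= rho x t).
{ apply (density_nonnegative alpha c m rho u F Hm HF); intros y; rewrite E0; apply Bounds. }
assert (Ev0 : forall x, rho (- x) 0 = rho x 0) by (intros y; rewrite !E0; symmetry; apply Even).
assert (Mono0 : forall x y, 0 <= x -> x <= y -> y <= 1 / 2 -> rho x 0 <= rho y 0).
{ intros y z Hy Hyz Hz; rewrite !E0.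
  assert (Dr : forall w, derivable_pt_lim rho0 w (D 1%nat w)) by (intros w; rewrite <- HD0; apply HD).
  assert (K := derive_lower_bound rho0 (D 1%nat) y z 0 Hyz
    (fun w _ => proj2 (is_derive_Reals _ _ _) (Dr w))
    (fun w Hw => Mono w ltac:(lra) _ (Dr w))); lra. }
(* This places [x] in [0, 1/2], where the second differences of [F] are nonnegative. *)
assert (Hd : delta_const alpha <= 1 / 4) by apply Rmin_l.
replace (- (c * kernel_constant alpha * m) * x) with
  (- (c * (kernel_constant alpha * (m * x)))) by ring.
apply (velocity_upper_bound alpha c m rho u F Ha Hc Hm HF); auto; [lra| |].
- intros y; apply (potential_odd alpha c m rho u F Ha Hc HF Ev0 Pos y t Ht).
- intros a h Hah.
  exact (potential_midpoint_convex alpha c m rho u F Ha Hc HF Ev0 Pos Mono0 a h t Hah Ht).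
Qed.
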